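(* For each fixed $d \geq 1$ and $n \geq 1$, $$\{\, p_{n}(F) : F \text{ is a continuous PRPD distribution function on } \mathbb{R}^d \,\} = [n^{-1}, p^*_n].$$ That is, the image of the mapping $F \mapsto p_n(F)$ on the domain of PRPD distributions on $\mathbb{R}^d$ is precisely the interval $[n^{-1}, p^*_n]$.
   Context: For $\mathbf{x}, \mathbf{y} \in \mathbb{R}^d$, write $\mathbf{x} \leq \mathbf{y}$ (equivalently $\mathbf{y} \geq \mathbf{x}$) if $x_j \leq y_j$ for all $1 \leq j \leq d$. All distribution functions $F$ on $\mathbb{R}^d$ are assumed continuous. Let $\mathbf{X}$ have distribution function $F$ and let $\mathbf{X}^{(1)}, \mathbf{X}^{(2)}, \dots$ be i.i.d. copies of $\mathbf{X}$. For $n \geq 1$, $\mathbf{X}^{(n)}$ sets a (Pareto) record if $\mathbf{X}^{(n)} \leq \mathbf{X}^{(i)}$ fails for all $1 \leq i < n$. Let $p_n(F) \equiv p_{n,d}(F)$ denote the probability that $\mathbf{X}^{(n)}$ sets a record. Let $H$ denote the distribution function of $-\mathbf{X}$, so that $H(-\mathbf{x}) = \mathbb{P}(\mathbf{X} \geq \mathbf{x})$. Given two continuous distribution functions $F$ and $\widetilde F$ on $\mathbb{R}^d$, of random vectors $\mathbf{X}$ and $\widetilde{\mathbf{X}}$, let $H$ and $\widetilde H$ be the distribution functions of $-\mathbf{X}$ and $-\widetilde{\mathbf{X}}$. Say $F$ and $\widetilde F$ are RP-equivalent if the random variables $H(-\mathbf{X})$ and $\widetilde H(-\widetilde{\mathbf{X}})$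 have the same distribution, and say $F \leq \widetilde F$ in the RP ordering if $H(-\mathbf{X}) \geq \widetilde H(-\widetilde{\mathbf{X}})$ stochastically, i.e., $\mathbb{P}(H(-\mathbf{X}) > t) \geq \mathbb{P}(\widetilde H(-\widetilde{\mathbf{X}}) > t)$ for every $t \in \mathbb{R}$. This is a partial order on RP-equivalence classes. All continuous distribution functions on $\mathbb{R}^d$ under which the $d$ coordinates are independent lie in a single RP-equivalence class, denoted $C^*$; $p^*_n$ denotes the common value of $p_n(F)$ for $F \in C^*$ (with the same $d$). A continuous $F$ is positively record-setting probability dependent (PRPD) if $F \leq F^*$ in the RP ordering, where $F^*$ is any element of $C^*$. *)

(* Defs.v *)
From HB Require Import structures.
From mathcomp Require Import all_boot all_order all_algebra.
From mathcomp Require Import all_classical all_reals all_analysis.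
From mathcomp Require Import measurable_realfun.

Set Implicit Arguments.
Unset Strict Implicit.
Unset Printing Implicit Defensive.

Import Order.TTheory GRing.Theory Num.Theory.
Import numFieldNormedType.Exports.

Local Open Scope classical_set_scope.
Local Open Scope ring_scope.

Section Power.
Context {disp : measure_display} {T : measurableType disp} {R : realType}.
Variable P : probability T R.

Definition cons_pair n (x : T * n.-tuple T) : n.+1.-tuple T :=
  [the n.+1.-tuple T of x.1 :: x.2].

Lemma measurable_cons_pair n : measurable_fun setT (@cons_pair n).
Proof. exact: measurable_cons. Qed.

HB.instance Definition _ n :=
  isMeasurableFun.Build _ _ _ _ (@cons_pair n) (@measurable_cons_pair n).

(* The n-fold product measure: the joint law of n i.i.d. variables of law P. *)
Fixpoint power_probability n : probability (n.-tuple T) R :=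
  match n with
  | 0 => \d_([tuple])
  | m.+1 => distribution (P \x power_probability m)%E (@cons_pair m)
  end.

End Power.

Section Vectors.
Context {R : realType} {d : nat}.
Implicit Types x y : d.-tuple R.

Definition le_vec x y : Prop := forall j, tnth x j <= tnth y j.

Definition opp_vec x : d.-tuple R := [tuple - tnth x j | j < d].

Lemma measurable_opp_vec : measurable_fun setT opp_vec.
Proof.
apply/measurable_fun_tnthP => j.
rewrite (_ : _ \o _ = fun x => - tnth x j); last first.
  by apply/funext => x /=; rewrite tnth_mktuple.
apply: measurableT_comp => //; exact: measurable_tnth.
Qed.

HB.instance Definition _ :=
  isMeasurableFun.Build _ _ _ _ opp_vec measurable_opp_vec.

End Vectors.

(* A distribution function on R^d is represented by the probability measure on
   R^d that it determines, of which it is the [joint_cdf]. *)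
Section DistributionFunctions.
Context {R : realType} {d : nat}.
Implicit Types F G : probability (d.-tuple R) R.

Definition joint_cdf F (x : d.-tuple R) : R := fine (F [set y | le_vec y x]).

(* Tuples carry no topology, hence the detour through row vectors. *)
Definition continuous_df F : Prop :=
  continuous (fun x : 'rV[R]_d => joint_cdf F [tuple x ord0 j | j < d]).

(* H, the distribution function of - X, for X of law F. *)
Definition opp_cdf F : d.-tuple R -> R := joint_cdf (distribution F opp_vec).

(* The random variable H(- X), on the probability space (R^d, F) with X = id. *)
Definition H_opp F (x : d.-tuple R) : R := opp_cdf F (opp_vec x).

Lemma measurable_H_opp F : measurable_fun setT (H_opp F).
Proof.
pose A : set (d.-tuple R * d.-tuple R) :=
  [set z | le_vec (opp_vec z.2) (opp_vec z.1)].
have mA : measurable A.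
  have -> : A = \big[setI/setT]_(j < d) [set z | tnth z.1 j <= tnth z.2 j].
    apply/seteqP; split=> z /=.
      move=> Az; elim/big_ind: _ => [|B C Bz Cz|j _] //=.
      by have := Az j; rewrite !tnth_mktuple lerN2.
    move=> zA j; rewrite !tnth_mktuple lerN2.
    by move: zA; rewrite (bigD1 j)//= => -[].
  apply: bigsetI_measurable => j _; rewrite -[X in measurable X]setTI.
  apply: measurable_fun_le => //.
    exact: (measurableT_comp (measurable_tnth j) measurable_fst).
  exact: (measurableT_comp (measurable_tnth j) measurable_snd).
rewrite (_ : H_opp F = fine \o (F \o xsection A)).
  apply: (measurableT_comp (fine_measurable measurableT)).
  exact: measurable_fun_xsection.
apply/funext => x /=; rewrite /H_opp /opp_cdf /joint_cdf /distribution.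
by congr (fine (F _)); apply/seteqP; split=> y; rewrite /xsection/= inE.
Qed.

HB.instance Definition _ F :=
  isMeasurableFun.Build _ _ _ _ (H_opp F) (measurable_H_opp F).

Definition rp_equiv F G : Prop :=
  forall A : set R, measurable A ->
    distribution F (H_opp F) A = distribution G (H_opp G) A.

(* F <= G when H(- X) is stochastically larger than its analogue for G: the
   inequality between the survival functions is reversed. *)
Definition rp_le F G : Prop :=
  forall t : R, (ccdf (P := G) (H_opp G) t <= ccdf (P := F) (H_opp F) t)%E.

Definition independent_coordinates F : Prop :=
  forall B : 'I_d -> set R, (forall j, measurable (B j)) ->
    fine (F [set x | forall j, B j (tnth x j)]) =
    \prod_(j < d) fine (F [set x | B j (tnth x j)]).

(* The RP-equivalence class C^* of the continuous distribution functions with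
   independent coordinates. *)
Definition Cstar F : Prop :=
  continuous_df F /\
  exists G, [/\ continuous_df G, independent_coordinates G & rp_equiv F G].

Definition PRPD F : Prop :=
  continuous_df F /\ forall G, Cstar G -> rp_le F G.

Definition sets_record n (x : n.-tuple (d.-tuple R)) (k : 'I_n) : Prop :=
  forall i : 'I_n, (i < k)%N -> ~ le_vec (tnth x k) (tnth x i).

(* Indices start at 0, so the n-th observation has index n - 1. *)
Definition record_prob n F : R :=
  fine (power_probability F n
    [set x | forall k : 'I_n, k.+1 = n -> sets_record x k]).

End DistributionFunctions.

(* The common value of p_n on C^*, obtained by choosing an element of C^*. *)
Definition record_prob_star (R : realType) (d n : nat) : R :=
  get [set record_prob n F | F in @Cstar R d].

(* Main.v *)
From HB Require Import structures.
Require Import Defs.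
From mathcomp Require Import all_boot all_order all_algebra.
From mathcomp Require Import all_classical all_reals all_analysis.
From mathcomp Require Import measurable_realfun.
From mathcomp Require Import ring lra.

Set Implicit Arguments.
Unset Strict Implicit.
Unset Printing Implicit Defensive.

Import Order.TTheory GRing.Theory Num.Theory.
Import numFieldNormedType.Exports.

Local Open Scope classical_set_scope.
Local Open Scope ring_scope.

(** Conditioning on the last observation gives
      [p_n(F) = E ((1 - H(-X)) ^ (n - 1))],
    since, given [X^(n) = x], each earlier observation independently fails to
    lie above [x] with probability [1 - H(-x)] ([record_probE]). So [p_n]
    depends on the law of [H(-X)] only, through a decreasing function of it.

    Upper end. A PRPD law has [H(-X)] stochastically larger than in the
    independent case, hence a smaller [p_n] ([antitone_integral_le],
    [record_prob_le]). Under independence with continuous margins, [H(-X)] is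
    the product of the marginal survival functions evaluated at the
    coordinates, and these are independent uniform variables
    ([survival_unif]), so [H(-X)] has the law of a product of [d] independent
    uniforms ([H_opp_law]). This is why [p*_n] does not depend on the element
    of [C^*] by which it is computed.

    Lower end. [H(-X)] is at most the survival function of the first
    coordinate evaluated at that coordinate, a uniform variable [U], and
    [E ((1 - U) ^ (n - 1)) = 1 / n] ([record_prob_ge]).

    Intermediate values. For [0 <= th <= 1] let [Z] be uniform on [0, 1] and
    [U_1, ..., U_d] independent uniforms. Put [X = (-1 - Z, ..., -1 - Z)] when
    [Z > th] and [X = (-U_1, ..., -U_d)] otherwise ([splice]): a comonotone
    block lies strictly below an independent one. A direct computation gives
      [H(-X) = Z] if [Z > th], and [H(-X) = th * U_1 * ... * U_d] otherwise
    ([H_opp_splice]). For [th = 0] this is uniform and for [th = 1] it is the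
    product of uniforms, so both ends of the interval are attained, and [p_n]
    is Lipschitz in [th] ([record_prob_splice_lip]); the intermediate value
    theorem supplies all the values in between.

    That this family is PRPD comes down to
      [th * P(th * W <= t) <= P(W <= t)], where [W = U_1 * ... * U_d]
    ([clamp_prod_contraction]); conditionally on the last [d - 1] factors it is
    an elementary property of the uniform distribution function
    ([unif_contraction]). *)

(** * The uniform law *)

Section clamp.
Context {R : realType}.
Implicit Types x y : R.

(** The distribution function of the uniform law on [0, 1]. It is also applied
    to uniform variables themselves, so that the bounds 0 and 1 hold for all
    outcomes and not just almost surely. *)
Definition clamp x : R := Num.max 0 (Num.min x 1).

Lemma clamp_ge0 x : 0 <= clamp x.
Proof. by rewrite /clamp le_max lexx. Qed.

Lemma clamp_le1 x : clamp x <= 1.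
Proof. by rewrite /clamp ge_max ler01 ge_min lexx orbT. Qed.

Lemma clamp_id x : 0 <= x <= 1 -> clamp x = x.
Proof. by move=> /andP[x0 x1]; rewrite /clamp (min_idPl _)// (max_idPr _). Qed.

Lemma clamp_eq0 x : x <= 0 -> clamp x = 0.
Proof.
by move=> x0; rewrite /clamp (max_idPl _)// ge_min x0.
Qed.

Lemma clamp_eq1 x : 1 <= x -> clamp x = 1.
Proof. by move=> x1; rewrite /clamp (min_idPr _)// (max_idPr _)// ler01. Qed.

Lemma clamp_homo x y : x <= y -> clamp x <= clamp y.
Proof.
move=> xy; rewrite /clamp ge_max !le_max lexx/=.
by rewrite le_min !ge_min xy lexx !orbT.
Qed.

Lemma clamp_lip x y : x <= y -> clamp y - clamp x <= y - x.
Proof.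
move=> xy; have [x0|x0] := leP x 0.
  rewrite (clamp_eq0 x0); have [y0|y0] := leP y 0; first by rewrite (clamp_eq0 y0); lra.
  have [y1|y1] := leP y 1; first by rewrite clamp_id; lra.
  by rewrite clamp_eq1; lra.
have [y1|y1] := leP y 1; first by rewrite !clamp_id; lra.
rewrite (@clamp_eq1 y); last lra.
have [x1|x1] := leP x 1; first by rewrite clamp_id; lra.
by rewrite clamp_eq1; lra.
Qed.

Lemma clamp_le r x : 0 <= r < 1 -> (clamp x <= r) = (x <= r).
Proof.
move=> /andP[r0 r1]; rewrite /clamp ge_max r0 ge_min/=.
by rewrite [1 <= r]leNgt r1 orbF.
Qed.

Lemma measurable_clamp : measurable_fun [set: R] clamp.
Proof.
apply: measurable_maxr => //; exact: measurable_minr.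
Qed.

HB.instance Definition _ :=
  isMeasurableFun.Build _ _ _ _ clamp measurable_clamp.

End clamp.

Section uniform.
Context (R : realType).

Let toR : measurableTypeR R -> R := idfun.

#[local] HB.instance Definition _ :=
  @isMeasurableFun.Build _ _ _ _ toR (@measurable_id _ _ setT).

Definition unif : probability R R := distribution (uniform_prob (@ltr01 R)) toR.

Lemma unif_le (r : R) : unif [set x | x <= r] = (clamp r)%:E.
Proof.
rewrite /unif /distribution /pushforward /= preimage_id /uniform_prob integral_uniform_pdf.
rewrite (eq_integral (fun=> 1%:E)); last first.
  move=> x; rewrite inE/= in_itv/= /uniform_pdf => -[_ ->].
  by rewrite subr0 invr1.
have [r0|r0] := ltP r 0.
  rewrite (_ : _ `&` _ = set0) ?integral_set0 ?clamp_eq0 ?ltW//.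
  by rewrite -subset0 => x /=; rewrite in_itv/=; lra.
rewrite (_ : _ `&` _ = `[0, clamp r]%classic); last first.
  apply/seteqP; split => x /=; rewrite !in_itv/= /clamp.
    by move=> [xr /andP[-> x1]]; rewrite le_max le_min xr x1 orbT.
  move=> /andP[-> ]; rewrite le_max le_min => /orP[x0|/andP[-> ->]]//.
  by rewrite !(le_trans x0)// ?ler01.
rewrite integral_cst//= mul1e lebesgue_measure_itv/= lte_fin.
case: ltP => [_|]; first by rewrite oppr0 adde0.
by have := clamp_ge0 r => ? ?; congr EFin; lra.
Qed.

Lemma integral_unif_onemX m :
  (\int[unif]_x ((1 - clamp x) ^+ m)%:E = (m.+1%:R^-1)%:E)%E.
Proof.
have mf : measurable_fun [set: R] (fun x : R => ((1 - clamp x) ^+ m)%:E).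
  apply/measurable_EFinP; apply: measurable_funX; exact: measurable_funB.
have f0 (x : R) : (0 <= ((1 - clamp x) ^+ m)%:E)%E.
  rewrite lee_fin exprn_ge0// subr_ge0; exact: clamp_le1.
rewrite ge0_integral_distribution// integral_uniform//=.
rewrite subr0 invr1 mul1e -Rintegral_onemXn /Rintegral fineK//; last first.
  apply: integrable_fin_num => //=.
  apply: continuous_compact_integrable; first exact: segment_compact.
  by apply: continuous_in_subspaceT => x x01; exact: continuous_onemXn.
apply: eq_integral => x; rewrite inE/= in_itv/= => x01.
by rewrite clamp_id.
Qed.

End uniform.

(** * Laws of independent observations *)

Section power.
Context {disp : measure_display} {T : measurableType disp} {R : realType}.
Variable P : probability T R.

Definition box n (B : 'I_n -> set T) : set (n.-tuple T) :=
  [set x | forall j, B j (tnth x j)].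

Lemma measurable_box n (B : 'I_n -> set T) :
  (forall j, measurable (B j)) -> measurable (box B).
Proof.
move=> mB.
have -> : box B = \big[setI/setT]_(j < n) [set x | B j (tnth x j)].
  apply/seteqP; split=> z /=.
    by move=> Bz; elim/big_ind: _ => [|C D Cz Dz|j _] //=; exact: Bz.
  by move=> zB j; move: zB; rewrite (bigD1 j)//= => -[].
apply: bigsetI_measurable => j _; rewrite -[X in measurable X]setTI.
exact: measurable_tnth.
Qed.

Lemma power_probability_box n (B : 'I_n -> set T) : (forall j, measurable (B j)) ->
  power_probability P n (box B) = (\prod_(j < n) P (B j))%E.
Proof.
elim: n B => [|n ih] B mB.
  by rewrite big_ord0 /= diracE mem_set// => -[].
rewrite /= /distribution /pushforward big_ord_recl.
pose B' (j : 'I_n) := B (lift ord0 j).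
have mB' : measurable (box B') by apply: measurable_box => j; exact: mB.
rewrite (_ : _ @^-1` _ = B ord0 `*` box B').
  by rewrite product_measure1E//; congr (_ * _)%E; apply: ih => j; exact: mB.
apply/seteqP; split => -[x y] /=.
  by move=> Bx; split; [exact: (Bx ord0)|move=> j];
    by have := Bx (lift ord0 j); rewrite tnthS.
move=> [Bx By] j; have [k ->|->] := unliftP ord0 j; last exact: Bx.
by rewrite tnthS; exact: By.
Qed.

(** Boxes form a pi-system that generates the measurable sets of tuples. *)
Lemma power_probability_unique n (nu : probability (n.-tuple T) R) :
  (forall B : 'I_n -> set T, (forall j, measurable (B j)) ->
    nu (box B) = (\prod_(j < n) P (B j))%E) ->
  forall A, measurable A -> nu A = power_probability P n A.
Proof.
move=> nuE A mA.
pose G : set (set (n.-tuple T)) :=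
  [set C | exists2 B : 'I_n -> set T, (forall j, measurable (B j)) & C = box B].
apply: (measure_unique G (fun=> setT)) => //.
- apply/seteqP; split; last first.
    apply: smallest_sub; first exact: sigma_algebra_measurable.
    by move=> _ [B mB ->]; exact: measurable_box.
  rewrite {1}/measurable/= /g_sigma_preimage.
  apply: smallest_sub; first exact: smallest_sigma_algebra.
  rewrite -bigcup_seq => C -[/= j _ [B mB <-]]; apply: sub_sigma_algebra.
  exists (fun i => if i == j then B else setT).
    by move=> i; case: ifP.
  apply/seteqP; split => x /=.
    by move=> [_ Bx] i; case: eqP => // ->.
  by move=> /(_ j); rewrite eqxx.
- move=> _ _ [B mB ->] [C mC ->]; exists (fun j => B j `&` C j).
    by move=> j; exact: measurableI.
  apply/seteqP; split => x /=; first by move=> [Bx Cx] j.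
  by move=> BCx; split => j; have [] := BCx j.
- move=> _; exists (fun=> setT) => //.
  by apply/seteqP.
- by apply/seteqP; split => // x _; exists 0%N.
- move=> _ [B mB ->]; transitivity (\prod_(j < n) P (B j))%E.
    exact: nuE.
  exact/esym/power_probability_box.
- by move=> k; apply: le_lt_trans (probability_le1 nu measurableT) (ltry _).
Qed.

End power.

(** * The probability of a record as a moment *)

Section records_of_relations.
Context {disp : measure_display} {T : measurableType disp} {R : realType}.
Variables (P : probability T R) (E : set (T * T)).
Hypothesis mE : measurable E.

(** With [E] the relation of not being dominated, the event that the last of
    [m + 1] observations sets a record. *)
Definition last_related_all m : set (m.+1.-tuple T) :=
  [set x | forall i : 'I_m.+1, (i < m)%N -> E (tnth x ord_max, tnth x i)].

Arguments last_related_all : clear implicits.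

Lemma measurable_last_related_all m : measurable (last_related_all m).
Proof.
have -> : last_related_all m = \big[setI/setT]_(i < m.+1 | (i < m)%N)
    [set x | E (tnth x ord_max, tnth x i)].
  apply/seteqP; split=> z /=.
    by move=> Bz; elim/big_ind: _ => [|C D Cz Dz|j jm] //=; exact: Bz.
  by move=> zB j jm; move: zB; rewrite (bigD1 j)//= => -[].
apply: bigsetI_measurable => j _; rewrite -[X in measurable X]setTI.
have : measurable_fun setT (fun x : m.+1.-tuple T => (tnth x ord_max, tnth x j)).
  by apply/measurable_fun_pair => /=; exact: measurable_tnth.
exact.
Qed.

Lemma fine_xsectionE y : (fine (P (xsection E y)))%:E = P (xsection E y).
Proof. by rewrite fineK// fin_num_measure//; exact: measurable_xsection. Qed.

Lemma measurable_fine_xsection :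
  measurable_fun setT (fun y => fine (P (xsection E y))).
Proof.
apply: (measurableT_comp (fine_measurable measurableT)).
exact: measurable_fun_xsection.
Qed.

(** Given the value [y] of the last observation, the [m] earlier ones are
    independent and each is related to [y] with the probability of a section
    of [E]. The weight [h] is there for the induction: integrating out the
    first observation multiplies it by that probability. *)
Lemma integral_last_related_all m (h : T -> \bar R) :
  measurable_fun setT h -> (forall y, 0 <= h y)%E ->
  (\int[power_probability P m.+1]_x
      ((\1_(last_related_all m) x)%:E * h (tnth x ord_max)) =
   \int[P]_y (h y * (fine (P (xsection E y)) ^+ m)%:E))%E.
Proof.
have m1E : measurable_fun setT (\1_E : T * T -> R) by exact: measurable_indic.
have m1A k : measurable_fun setT (\1_(last_related_all k) : k.+1.-tuple T -> R).
  by apply: measurable_indic; exact: measurable_last_related_all.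
elim: m h => [|m ih] h mh h0.
  rewrite ge0_integral_distribution; last 2 first.
  - apply: emeasurable_funM.
      by apply/measurable_EFinP; exact: m1A.
    by apply: measurableT_comp => //; exact: measurable_tnth.
  - by move=> y; rewrite mule_ge0.
  rewrite (_ : _ \o _ = fun z : T * 0.-tuple T => h z.1); last first.
    by apply/funext => -[x y] /=; rewrite indicE mem_set ?mul1e.
  rewrite fubini_tonelli1/=; last 2 first.
    by apply: measurableT_comp => //; exact: measurable_fst.
    by move=> z; exact: h0.
  apply: eq_integral => x _; rewrite /fubini_F/= expr0 mule1.
  by rewrite integral_cst//= diracE mem_set// mule1.
rewrite ge0_integral_distribution; last 2 first.
- apply: emeasurable_funM.
    by apply/measurable_EFinP; exact: m1A.
  by apply: measurableT_comp => //; exact: measurable_tnth.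
- by move=> y; rewrite mule_ge0.
have lastc (x : T) (y : m.+1.-tuple T) :
    tnth (cons_pair (x, y)) ord_max = tnth y ord_max.
  by rewrite (_ : ord_max = lift ord0 ord_max) ?tnthS//; apply/val_inj.
rewrite (_ : _ \o _ = fun z : T * m.+1.-tuple T =>
    ((\1_E (tnth z.2 ord_max, z.1))%:E *
     ((\1_(last_related_all m) z.2)%:E * h (tnth z.2 ord_max)))%E); last first.
  apply/funext => -[x y] /=; rewrite muleA lastc -EFinM !indicE -natrM mulnb.
  congr (((nat_of_bool _)%:R)%:E * _)%E; apply/idP/andP; rewrite !inE.
    move=> Axy; split.
      by have := Axy ord0 (ltn0Sn _); rewrite lastc.
    move=> i im; have := Axy (lift ord0 i); rewrite lastc tnthS; apply.
    by rewrite lift0.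
  move=> [Exy Ay] i; rewrite lastc.
  have [k ->|->] := unliftP ord0 i; last by [].
  by rewrite tnthS lift0 ltnS; exact: Ay.
have mf : measurable_fun setT (fun z : T * m.+1.-tuple T =>
    ((\1_E (tnth z.2 ord_max, z.1))%:E *
     ((\1_(last_related_all m) z.2)%:E * h (tnth z.2 ord_max)))%E).
  apply: emeasurable_funM.
    apply/measurable_EFinP; apply: (measurableT_comp m1E).
    apply/measurable_fun_pair => //=.
    exact: (measurableT_comp (measurable_tnth _) measurable_snd).
  apply: emeasurable_funM.
    apply/measurable_EFinP; apply: (measurableT_comp (m1A m)) => //.
  apply: (measurableT_comp mh).
  exact: (measurableT_comp (measurable_tnth _) measurable_snd).
(* the first observation is integrated first, the others being fixed *)
rewrite fubini_tonelli2//; last by move=> z /=; rewrite !mule_ge0.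
transitivity (\int[power_probability P m.+1]_y ((\1_(last_related_all m) y)%:E *
   (h (tnth y ord_max) * (fine (P (xsection E (tnth y ord_max))))%:E)))%E.
  apply: eq_integral => y _; rewrite /fubini_G/=.
  rewrite ge0_integralZr//=; last 2 first.
  - apply/measurable_EFinP.
    by apply: (measurableT_comp m1E); exact: measurable_pair1.
  - by rewrite mule_ge0.
  rewrite muleC -muleA fine_xsectionE; congr (_ * (_ * _))%E.
  have mEy : measurable (xsection E (tnth y ord_max)) by exact: measurable_xsection.
  transitivity (\int[P]_x (\1_(xsection E (tnth y ord_max)) x)%:E)%E.
    apply: eq_integral => x _; congr (_%:R)%:E; congr nat_of_bool.
    by apply/idP/idP; rewrite !inE /xsection/= inE.
  by rewrite integral_indic// setIT.
rewrite (ih (fun y => h y * (fine (P (xsection E y)))%:E)%E); last 2 first.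
- by apply: emeasurable_funM => //; apply/measurable_EFinP;
    exact: measurable_fine_xsection.
- by move=> y; rewrite mule_ge0// fine_xsectionE.
by apply: eq_integral => y _; rewrite -muleA -EFinM -exprS.
Qed.

End records_of_relations.

Arguments last_related_all {disp T} E m.
Section record_formula.
Context {R : realType}.

Definition record_fun m (y : R) : R := (1 - clamp y) ^+ m.

Lemma record_fun_ge0 m y : 0 <= record_fun m y.
Proof. by rewrite exprn_ge0// subr_ge0 clamp_le1. Qed.

Lemma record_fun_le1 m y : record_fun m y <= 1.
Proof.
by rewrite exprn_ile1// ?subr_ge0 ?clamp_le1// lerBlDr lerDl clamp_ge0.
Qed.

Lemma record_fun_homo m x y : x <= y -> record_fun m y <= record_fun m x.
Proof.
move=> xy; rewrite lerXn2r ?nnegrE ?subr_ge0 ?clamp_le1//.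
by rewrite lerD2l lerN2 clamp_homo.
Qed.

Lemma measurable_record_fun m : measurable_fun [set: R] (record_fun m).
Proof. by apply: measurable_funX; exact: measurable_funB. Qed.

HB.instance Definition _ m :=
  isMeasurableFun.Build _ _ _ _ (record_fun m) (measurable_record_fun m).

Context {d : nat}.
Implicit Types F : probability (d.-tuple R) R.

Lemma measurable_le_vec :
  measurable [set z : d.-tuple R * d.-tuple R | le_vec z.1 z.2].
Proof.
have -> : [set z : d.-tuple R * d.-tuple R | le_vec z.1 z.2] =
    \big[setI/setT]_(j < d) [set z | tnth z.1 j <= tnth z.2 j].
  apply/seteqP; split=> z /=.
    by move=> zl; elim/big_ind: _ => [|B C Bz Cz|j _] //=; exact: zl.
  by move=> zA j; move: zA; rewrite (bigD1 j)//= => -[].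
apply: bigsetI_measurable => j _; rewrite -[X in measurable X]setTI.
apply: measurable_fun_le => //.
  exact: (measurableT_comp (measurable_tnth j) measurable_fst).
exact: (measurableT_comp (measurable_tnth j) measurable_snd).
Qed.

Lemma measurable_ge_vec (x : d.-tuple R) : measurable [set y | le_vec x y].
Proof.
have := @measurable_xsection _ _ _ _ _ x measurable_le_vec.
by congr measurable; apply/seteqP; split=> y; rewrite /xsection/= inE.
Qed.

Lemma H_oppE F x : (H_opp F x)%:E = F [set y | le_vec x y].
Proof.
transitivity (fine (F [set y | le_vec x y]))%:E; last first.
  by rewrite fineK// fin_num_measure//; exact: measurable_ge_vec.
rewrite /H_opp /opp_cdf /joint_cdf /distribution /pushforward /=.
congr (fine (F _))%:E; apply/seteqP; split => y /= yx j; have := yx j;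
  by rewrite !tnth_mktuple lerN2.
Qed.

Lemma H_opp_ge0 F x : 0 <= H_opp F x.
Proof. by rewrite -lee_fin H_oppE. Qed.

Lemma H_opp_le1 F x : H_opp F x <= 1.
Proof.
by rewrite -lee_fin H_oppE; apply: probability_le1; exact: measurable_ge_vec.
Qed.

(** The section of the relation at [x] is the event of not lying above [x],
    whose probability is [1 - H_opp F x]. *)
Lemma record_probE F m : (record_prob m.+1 F)%:E =
  (\int[distribution F (H_opp F)]_y (record_fun m y)%:E)%E.
Proof.
have mE : measurable [set z : d.-tuple R * d.-tuple R | ~ le_vec z.1 z.2].
  by apply: measurableC; exact: measurable_le_vec.
have -> : record_prob m.+1 F = fine (power_probability F m.+1
    (last_related_all [set z | ~ le_vec z.1 z.2] m)).
  congr (fine (power_probability F m.+1 _)); apply/seteqP; split => x /=.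
    by move=> xR i im; exact: (xR ord_max).
  move=> xA k [km] i ik; have -> : k = ord_max by apply/val_inj.
  by apply: xA; rewrite -[X in (_ < X)%N]km.
rewrite fineK; last by rewrite fin_num_measure//; exact: measurable_last_related_all.
have := @integral_last_related_all _ _ _ F _ mE m (fun=> 1%E) (measurable_cst _).
under eq_integral do rewrite mule1.
rewrite integral_indic//; last exact: measurable_last_related_all.
rewrite setIT => -> //.
rewrite ge0_integral_distribution//; last 2 first.
- by apply/measurable_EFinP; exact: measurable_record_fun.
- by move=> y; rewrite lee_fin record_fun_ge0.
apply: eq_integral => x _; rewrite mul1e /= /record_fun.
congr ((_ ^+ m)%:E); rewrite clamp_id; last by rewrite H_opp_ge0 H_opp_le1.
apply: EFin_inj; rewrite fine_xsectionE// EFinB H_oppE.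
rewrite -probability_setC; last exact: measurable_ge_vec.
by congr (F _); apply/seteqP; split => y; rewrite /xsection/= inE.
Qed.

End record_formula.

(** * Laws on the real line *)

Section real_laws.
Context {R : realType}.
Implicit Types mu nu : probability R R.

Lemma measurable_lt (a : R) : measurable [set x : R | x < a].
Proof. by rewrite -set_itvNyo; exact: measurable_itv. Qed.

Lemma measurable_le (a : R) : measurable [set x : R | x <= a].
Proof. by rewrite -set_itvNyc; exact: measurable_itv. Qed.

Lemma measurable_gt (a : R) : measurable [set x : R | a < x].
Proof. by rewrite -set_itvoy; exact: measurable_itv. Qed.

Lemma measurable_ge (a : R) : measurable [set x : R | a <= x].
Proof. by rewrite -set_itvcy; exact: measurable_itv. Qed.

Lemma measure_bigcup_le {disp} {T : measurableType disp} (mu : probability T R)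
    (A : (set T)^nat) (c : \bar R) :
  (forall n, measurable (A n)) -> nondecreasing_seq A ->
  (forall n, mu (A n) <= c)%E -> (mu (\bigcup_n A n) <= c)%E.
Proof.
move=> mA ndA muA.
have := @nondecreasing_cvg_mu _ _ _ mu A mA (bigcup_measurable (fun k _ => mA k)) ndA.
move=> /cvg_lim <-//; apply: lime_le; last exact: nearW.
by apply: ereal_nondecreasing_is_cvgn => m n mn; apply: le_measure;
  rewrite ?inE//; exact/subsetPset/ndA.
Qed.

Lemma measure_lt_le mu (s : R) (c : \bar R) :
  (forall x, x < s -> (mu [set y | (y <= x)%R] <= c)%E) ->
  (mu [set y | (y < s)%R] <= c)%E.
Proof.
move=> muc; have -> : [set y | y < s] = \bigcup_n [set y | y <= s - n.+1%:R^-1].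
  apply/seteqP; split => x /=.
    by move=> /ltr_add_invr[k xk]; exists k => //=; rewrite lerBrDr ltW.
  by move=> [k _ /=] /le_lt_trans; apply; rewrite gtrBl.
apply: measure_bigcup_le => [n|m n mn|n]; first exact: measurable_le.
  apply/subsetPset => x /= /le_trans; apply.
  by rewrite lerD2l lerN2 lef_pV2 ?posrE// ler_nat.
by apply: muc; rewrite gtrBl.
Qed.

Lemma measure_gt_le mu (s : R) (c : \bar R) :
  (forall x, s < x -> (mu [set y | (x <= y)%R] <= c)%E) ->
  (mu [set y | (s < y)%R] <= c)%E.
Proof.
move=> muc; have -> : [set y | s < y] = \bigcup_n [set y | s + n.+1%:R^-1 <= y].
  apply/seteqP; split => x /=.
    by move=> /ltr_add_invr[k xk]; exists k => //=; exact: ltW.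
  by move=> [k _ /=]; apply: lt_le_trans; rewrite ltrDl.
apply: measure_bigcup_le => [n|m n mn|n]; first exact: measurable_ge.
  apply/subsetPset => x /=; apply: le_trans.
  by rewrite lerD2l lef_pV2 ?posrE// ler_nat.
by apply: muc; rewrite ltrDl.
Qed.

Lemma measure_leE mu (a : R) : mu [set x | x <= a] = (1 - mu [set x | (a < x)%R])%E.
Proof.
rewrite -probability_setC; last exact: measurable_gt.
by congr (mu _); apply/seteqP; split => x /=; rewrite leNgt => /negP.
Qed.

Lemma measure_geE mu (a : R) : mu [set x | a <= x] = (1 - mu [set x | (x < a)%R])%E.
Proof.
rewrite -probability_setC; last exact: measurable_lt.
by congr (mu _); apply/seteqP; split => x /=; rewrite leNgt => /negP.
Qed.

(** A nonempty lower set that is not the whole line is a ray ending at its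
    supremum. Closed rays are complements of the open upper rays of the
    hypothesis, and open ones are increasing unions of closed ones. *)
Lemma lower_set_probability_le mu nu (A : set R) :
  (forall t, nu [set x | (t < x)%R] <= mu [set x | (t < x)%R])%E ->
  (forall x y, x <= y -> A y -> A x) -> (mu A <= nu A)%E.
Proof.
move=> numu dA.
have munu t : (mu [set x | (x <= t)%R] <= nu [set x | (x <= t)%R])%E.
  by rewrite !measure_leE leeB.
have [->|/set0P A0] := eqVneq A set0; first by rewrite !measure0.
have [ubA|ubA] := pselect (has_ubound A); last first.
  have -> : A = setT.
    apply/seteqP; split => // x _; apply: contrapT => Ax; apply: ubA.
    exists x => y Ay; rewrite leNgt; apply/negP => xy; apply: Ax.
    by apply: dA Ay; exact: ltW.
  by rewrite (@probability_setT _ _ _ mu) (@probability_setT _ _ _ nu).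
have lA x : x < sup A -> A x.
  by move=> xs; have [y Ay xy] := sup_gt A0 xs; apply: dA Ay; exact: ltW.
have [As|As] := pselect (A (sup A)).
  rewrite (_ : A = [set x | x <= sup A]) //.
  apply/seteqP; split => x /=; last by move=> xs; exact: dA As.
  by move=> Ax; exact: ub_le_sup.
rewrite (_ : A = [set x | x < sup A]) /=; last first.
  apply/seteqP; split => x /=; last exact: lA.
  move=> Ax; rewrite lt_neqAle ub_le_sup// andbT.
  by apply: contra_notN As => /eqP <-.
apply: measure_lt_le => x xs; apply: (le_trans (munu x)).
apply: le_measure; rewrite ?inE; [exact: measurable_le|exact: measurable_lt|].
by move=> y /= /le_lt_trans; exact.
Qed.

(** By the tail formula for expectations, as the superlevel sets of a
    nonincreasing function are lower sets. *)
Lemma antitone_integral_le mu nu (g : {mfun R >-> R}) :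
  (forall t, nu [set x | (t < x)%R] <= mu [set x | (t < x)%R])%E ->
  (forall x, 0 <= g x) -> {homo g : x y /~ x <= y} ->
  (\int[mu]_x (g x)%:E <= \int[nu]_x (g x)%:E)%E.
Proof.
move=> numu g0 ag.
have := @ge0_expectation_ccdf _ _ _ mu g g0; rewrite unlock => ->.
have := @ge0_expectation_ccdf _ _ _ nu g g0; rewrite unlock => ->.
apply: ge0_le_integral => //=.
- by apply: measurable_funTS; exact: ccdf_measurable.
- by apply: measurable_funTS; exact: ccdf_measurable.
move=> r _; rewrite /ccdf /distribution /pushforward.
apply: lower_set_probability_le => // x y xy /=.
rewrite !in_itv/= !andbT => /lt_le_trans; apply.
exact: ag.
Qed.

(** The probability integral transform, for the survival function. *)
Lemma law_survival_uniform mu (t : R) : (forall a, mu [set a] = 0%E) ->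
  mu [set x | fine (mu [set y | (x <= y)%R]) <= t] = (clamp t)%:E.
Proof.
move=> mu0; set S := fun x => fine (mu [set y | x <= y]).
have SE x : (S x)%:E = mu [set y | x <= y].
  by rewrite fineK// fin_num_measure//; exact: measurable_ge.
have S0 x : 0 <= S x by rewrite -lee_fin SE.
have S1 x : S x <= 1.
  by rewrite -lee_fin SE probability_le1//; exact: measurable_ge.
have Smono x y : x <= y -> S y <= S x.
  move=> xy; rewrite -lee_fin !SE le_measure ?inE//=;
    [exact: measurable_ge|exact: measurable_ge|].
  by move=> z /=; exact: le_trans.
have gtE a : mu [set x | a < x] = (S a)%:E.
  rewrite SE; apply/eqP; rewrite eq_le; apply/andP; split.
    apply: le_measure; rewrite ?inE; [exact: measurable_gt|exact: measurable_ge|].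
    by move=> x /=; exact: ltW.
  rewrite -[leRHS]add0e -(mu0 a); apply: le_trans (measureU2 _ _ _) => //; last first.
    exact: measurable_gt.
  apply: le_measure; rewrite ?inE; first exact: measurable_ge.
    by apply: measurableU => //; exact: measurable_gt.
  by move=> x /=; rewrite le_eqVlt => /orP[/eqP ->|]; [left|right].
have [t0|t0] := ltP t 0.
  rewrite clamp_eq0 ?ltW// (_ : mkset _ = set0) ?measure0//.
  by rewrite -subset0 => x /=; have := S0 x; rewrite /S => ? ?; lra.
have [t1|t1] := leP 1 t.
  rewrite clamp_eq1// (_ : mkset _ = setT) ?probability_setT//.
  by apply/seteqP; split => // x _ /=; have := S1 x; rewrite /S => ?; lra.
rewrite clamp_id ?t0 ?ltW//.
set D := [set x | S x <= t]; rewrite -/D.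
have upD x y : x <= y -> D x -> D y.
  by move=> xy; apply: le_trans; exact: Smono.
(* the survival function tends to 1 > t at -oo *)
have lbD : has_lbound D.
  have : (mu [set y | (y < - n%:R)%R] @[n --> \oo] --> mu set0)%E.
    rewrite (_ : set0 = \bigcap_n [set y : R | y < - n%:R]); last first.
      apply/esym; rewrite -subset0 => x /(_ (Num.bound x) I)/=.
      by rewrite ltNge => /negP; apply; rewrite lerNl ltW// unstable.ltrNbound.
    apply: nonincreasing_cvg_mu => //.
    - exact: le_lt_trans (probability_le1 mu (measurable_lt _)) (ltry _).
    - by move=> n; exact: measurable_lt.
    - by apply: bigcap_measurable => // k _; exact: measurable_lt.
    - move=> m n mn; apply/subsetPset => x /= /lt_le_trans; apply.
      by rewrite lerN2 ler_nat.
  rewrite measure0 => /fine_cvgP[_] /cvgrPdist_lt /(_ (1 - t)).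
  rewrite subr_gt0 => /(_ t1) [N _ /(_ N (leqnn N))] /=.
  rewrite sub0r normrN ger0_norm; last by rewrite fine_ge0.
  move=> HN; exists (- N%:R) => x Dx; rewrite leNgt; apply/negP => xN.
  have := Smono _ _ (ltW xN); move: Dx; rewrite /D/= => Dx SN.
  have : (S (- N%:R))%:E = (1 - fine (mu [set y | y < - N%:R]))%:E.
    rewrite SE measure_geE EFinB fineK// fin_num_measure//; exact: measurable_lt.
  by move=> [SNE]; lra.
(* D can only be empty for t = 0, as the survival function tends to 0 *)
have [D0|/set0P D0] := eqVneq D set0.
  rewrite D0 measure0; congr EFin; apply/eqP; rewrite eq_le t0/=.
  have : (mu [set y | (n%:R <= y)%R] @[n --> \oo] --> mu set0)%E.
    rewrite (_ : set0 = \bigcap_n [set y : R | n%:R <= y]); last first.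
      apply/esym; rewrite -subset0 => x /(_ (Num.bound x) I)/=.
      by rewrite leNgt => /negP; apply; rewrite unstable.ltr_bound.
    apply: nonincreasing_cvg_mu => //.
    - exact: le_lt_trans (probability_le1 mu (measurable_ge _)) (ltry _).
    - by move=> n; exact: measurable_ge.
    - by apply: bigcap_measurable => // k _; exact: measurable_ge.
    - by move=> m n mn; apply/subsetPset => x /=; apply: le_trans; rewrite ler_nat.
  rewrite measure0 => /fine_cvgP[_] /cvgrPdist_lt.
  rewrite leNgt => H; apply/negP => tp; have [N _ /(_ N (leqnn N))] := H _ tp.
  rewrite /= sub0r normrN ger0_norm; last by rewrite fine_ge0.
  move=> SN; have : D N%:R by exact: ltW.
  by rewrite D0.
(* otherwise D is an upper ray from a, closed or open: both have mass S a in
   the absence of atoms, and S a = t by continuity at a from either side *)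
set a := inf D.
have Da x : a < x -> D x.
  by move=> ax; have [y Dy yx] := inf_lt D0 ax; apply: upD Dy; exact: ltW.
have aD x : D x -> a <= x by move=> Dx; exact: ge_inf.
have muD : mu D = (S a)%:E.
  have [Da'|Da'] := pselect (D a).
    rewrite SE (_ : D = [set x | a <= x])//.
    by apply/seteqP; split => x /=; [exact: aD|move=> ax; exact: upD Da'].
  rewrite -gtE (_ : D = [set x | a < x])//.
  apply/seteqP; split => x /=; last exact: Da.
  move=> Dx; rewrite lt_neqAle aD// andbT.
  by apply: contra_notN Da' => /eqP ->.
rewrite muD; apply/eqP; rewrite eq_le; apply/andP; split.
  rewrite -gtE; apply: measure_gt_le => x ax; rewrite -SE lee_fin.
  exact: Da.
rewrite SE measure_geE.
rewrite leeBrDr ?fin_num_measure//; last exact: measurable_lt.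
rewrite -leeBrDl// -EFinB; apply: measure_lt_le => x xa.
have [y xy ya] : exists2 y, x < y & y < a.
  by exists ((x + a) / 2%:R); rewrite ?midf_lt//; lra.
apply: (@le_trans _ _ (mu [set z | z < y])).
  apply: le_measure; rewrite ?inE; [exact: measurable_le|exact: measurable_lt|].
  by move=> z /= /le_lt_trans; exact.
have Dy : t < S y.
  by rewrite ltNge; apply/negP => Dy; have := aD y Dy; rewrite leNgt ya.
have := SE y; rewrite measure_geE => Sy.
have f : mu [set z | (z < y)%R] \is a fin_num.
  by rewrite fin_num_measure//; exact: measurable_lt.
move: Sy; rewrite -(fineK f) -EFinB => -[] Sy.
by rewrite lee_fin; lra.
Qed.

(** The closed interval is enlarged by [e] on the left because the hypothesis
    only measures half-open intervals. *)
Lemma uniform_itv {disp} {T : measurableType disp} (P : probability T R)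
    (f : T -> R) (a b : R) : measurable_fun setT f ->
  (forall t, P [set x | (f x <= t)%R] = (clamp t)%:E) -> a <= b ->
  (P [set x | (a <= f x <= b)%R] <= (b - a)%:E)%E.
Proof.
move=> mf Pf ab; apply/lee_addgt0Pr => e e0; rewrite -EFinD.
have mle t : measurable [set x | f x <= t].
  by rewrite -[X in measurable X]setTI; exact: (mf measurableT _ (measurable_le t)).
apply: (@le_trans _ _ ((clamp b)%:E - (clamp (a - e))%:E)%E); last first.
  by rewrite -EFinB lee_fin; have := @clamp_lip _ (a - e) b; lra.
have mab : measurable [set x | a <= f x <= b].
  rewrite -[X in measurable X]setTI; apply: (mf measurableT [set x | a <= x <= b]).
  by have := measurable_itv `[a, b]; rewrite set_itvcc.
rewrite leeBrDr// -!Pf -measureU//.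
  apply: le_measure; rewrite ?inE//; first exact: measurableU.
  by move=> x /= [/andP[]//|]; lra.
by rewrite -subset0 => x /= [/andP[]]; lra.
Qed.

End real_laws.

(** * Continuity of a distribution function and its margins *)

Section continuity.
Context {R : realType} {d : nat}.
Implicit Types F : probability (d.-tuple R) R.

Lemma measurable_coord (j : 'I_d) (B : set R) :
  measurable B -> measurable [set x : d.-tuple R | B (tnth x j)].
Proof.
by move=> mB; rewrite -[X in measurable X]setTI; exact: measurable_tnth.
Qed.

Lemma measurable_le_vecr (x : d.-tuple R) : measurable [set y | le_vec y x].
Proof.
apply: (measurable_box (B := fun j => [set y : R | y <= tnth x j])) => j.
exact: measurable_le.
Qed.

Lemma joint_cdfE F x : (joint_cdf F x)%:E = F [set y | le_vec y x].
Proof. by rewrite fineK// fin_num_measure//; exact: measurable_le_vecr. Qed.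

(** If the hyperplane had positive mass, so would its part where the other
    coordinates are at most some [n], and the joint distribution function
    would jump at the corner of that part. *)
Lemma continuous_df_atomless F j (a : R) :
  continuous_df F -> F [set x | tnth x j = a] = 0%E.
Proof.
move=> cF.
pose A n := [set x : d.-tuple R |
  tnth x j = a /\ forall i, tnth x i <= Num.max a n%:R].
have AE n : A n = [set x | tnth x j = a] `&`
    [set y | le_vec y [tuple Num.max a n%:R | i < d]].
  by apply/seteqP; split => x /= [xa xn]; split => // i; have := xn i;
    rewrite tnth_mktuple.
have mA n : measurable (A n).
  rewrite AE; apply: measurableI; last exact: measurable_le_vecr.
  exact: (@measurable_coord j [set a]).
have -> : [set x | tnth x j = a] = \bigcup_n A n.
  apply/seteqP; split => x /=; last by move=> [n _ []].
  move=> xa; exists (\max_(i < d) Num.bound (tnth x i))%N => //; split => // i.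
  rewrite le_max; apply/orP; right; rewrite (le_trans (ltW (unstable.ltr_bound _)))//.
  by rewrite ler_nat leq_bigmax.
apply/eqP; rewrite -measure_le0; apply: measure_bigcup_le => //.
  move=> m n mn; apply/subsetPset => x /= [xa xm]; split => // i.
  apply: le_trans (xm i) _; rewrite ge_max !le_max lexx/= ler_nat mn orbT//.
move=> n; apply/lee_addgt0Pr => e e0; rewrite add0e.
pose v : 'rV[R]_d := \row_i (if i == j then a else Num.max a n%:R).
have /cvgrPdist_lt /(_ e e0) /nbhs_ballP [r /= r0 vr] := cF v.
pose w : 'rV[R]_d := \row_i (if i == j then a - r / 2 else Num.max a n%:R).
have /vr /= : ball v r w.
  split=> // i k; rewrite /ball/= !mxE; case: ifP => _; rewrite ?subrr ?normr0//.
  by rewrite opprB addrC subrK ger0_norm; lra.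
move=> vw; rewrite (@le_trans _ _ ((joint_cdf F [tuple v ord0 j | j < d])%:E -
   (joint_cdf F [tuple w ord0 j | j < d])%:E)%E)//; last first.
  by rewrite -EFinB lee_fin (le_trans _ (ltW vw))// ler_norm.
rewrite leeBrDr// joint_cdfE -measureU//; last 2 first.
- exact: measurable_le_vecr.
- rewrite -subset0 => x /= [[xa _]] /(_ j).
  by rewrite tnth_mktuple mxE eqxx xa; lra.
rewrite joint_cdfE le_measure ?inE//.
- by apply: measurableU => //; exact: measurable_le_vecr.
- exact: measurable_le_vecr.
move=> x /= [[xa xn] i|xw i]; rewrite tnth_mktuple mxE; last first.
  have := xw i; rewrite tnth_mktuple mxE; case: ifP => // _; lra.
case: eqP => [->|_]; first by rewrite xa.
exact: xn.
Qed.

(** Moving the corner of an orthant by at most [r] in each coordinate changes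
    it only inside the union of the slabs of width [2 * r] around the old
    corner. *)
Lemma lipschitz_continuous_df F (C : R) :
  (forall j a b, a <= b ->
    (F [set x | (a <= tnth x j <= b)%R] <= (C * (b - a))%:E)%E) ->
  continuous_df F.
Proof.
move=> FC v; pose f := fun x : 'rV[R]_d => joint_cdf F [tuple x ord0 j | j < d].
apply/(@cvgrPdist_lt _ R^o _ (nbhs v) (nbhs_filter v) f (f v)) => e e0.
have C0 : (0 < d)%N -> 0 <= C.
  move=> d0; have := FC (Ordinal d0) 0 1 ler01; rewrite subr0 mulr1 -lee_fin.
  exact: le_trans.
(* the d slabs of width 2 r have total mass at most |C| * 2 * d * r < e;
   the term 1 makes K positive when C or d vanishes *)
pose K := `|C| * 2 * d%:R + 1.
have K0 : 0 < K by rewrite ltr_pwDr// !mulr_ge0.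
pose r := e / K; have r0 : 0 < r by rewrite divr_gt0.
apply/nbhs_ballP; exists r => //= w vw.
pose N (j : 'I_d) := [set x : d.-tuple R | v ord0 j - r <= tnth x j <= v ord0 j + r].
have mN j : measurable (N j).
  apply: (@measurable_coord j [set x | v ord0 j - r <= x <= v ord0 j + r]).
  by have := measurable_itv (`[v ord0 j - r, v ord0 j + r]); rewrite set_itvcc.
pose NN := \big[setU/set0]_(j < d) N j.
have NNP x : (exists j, N j x) -> NN x.
  by move=> [j Njx]; rewrite /NN (bigD1 j)//=; left.
have mNN : measurable NN by exact: bigsetU_measurable.
have FN : (F NN <= (`|C| * 2 * d%:R * r)%:E)%E.
  apply: (@le_trans _ _ (\sum_(j < d) (`|C| * 2 * r)%:E)%E).
    apply: (@le_trans _ _ (\sum_(j < d) F (N j))%E).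
      rewrite /NN; elim: (index_enum _) => [|j s ih].
        by rewrite !big_nil measure0.
      rewrite !big_cons; apply: le_trans (leeD2l _ ih); apply: measureU2 => //.
      exact: bigsetU_measurable.
    apply: lee_sum => j _; apply: le_trans (FC _ _ _ _) _; first lra.
    rewrite lee_fin -mulrA ler_pM// ?ler_norm//; last lra.
      by apply: C0; exact: leq_ltn_trans (ltn_ord j).
    lra.
  by rewrite sumEFin lee_fin sumr_const card_ord -[leLHS]mulr_natr mulrAC lexx.
have vwi i : `|v ord0 i - w ord0 i| < r by have [_ ] := vw; exact.
have mv := measurable_le_vecr [tuple v ord0 j | j < d].
have mw := measurable_le_vecr [tuple w ord0 j | j < d].
have FNr : `|C| * 2 * d%:R * r < e.
  have -> : e = K * r by rewrite /r mulrC divfK// gt_eqF.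
  by rewrite ltr_pM2r// /K ltrDl.
have key (x y : d.-tuple R) :
    measurable [set z | le_vec z x] -> measurable [set z | le_vec z y] ->
    [set z | le_vec z x] `<=` [set z | le_vec z y] `|` NN ->
    joint_cdf F x <= joint_cdf F y + `|C| * 2 * d%:R * r.
  move=> mx my xy; rewrite -lee_fin EFinD !joint_cdfE.
  apply: le_trans (leeD2l _ FN); apply: le_trans (measureU2 _ _ _) => //.
  by apply: le_measure; rewrite ?inE//; exact: measurableU.
have vw1 : joint_cdf F [tuple v ord0 j | j < d] <=
    joint_cdf F [tuple w ord0 j | j < d] + `|C| * 2 * d%:R * r.
  apply: key => // x /= xv.
  have [|/existsNP[j /negP]] := pselect (le_vec x [tuple w ord0 j | j < d]); first by left.
  rewrite -ltNge tnth_mktuple => wx; right; apply: NNP; exists j => /=.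
  have := xv j; rewrite tnth_mktuple => xv'; have := vwi j; rewrite ltr_norml.
  by move=> /andP[? ?]; apply/andP; split; lra.
have vw2 : joint_cdf F [tuple w ord0 j | j < d] <=
    joint_cdf F [tuple v ord0 j | j < d] + `|C| * 2 * d%:R * r.
  apply: key => // x /= xv.
  have [|/existsNP[j /negP]] := pselect (le_vec x [tuple v ord0 j | j < d]); first by left.
  rewrite -ltNge tnth_mktuple => wx; right; apply: NNP; exists j => /=.
  have := xv j; rewrite tnth_mktuple => xv'; have := vwi j; rewrite ltr_norml.
  by move=> /andP[? ?]; apply/andP; split; lra.
have {}vw1 : f v <= f w + `|C| * 2 * d%:R * r := vw1.
have {}vw2 : f w <= f v + `|C| * 2 * d%:R * r := vw2.
by move: vw1 vw2 FNr; rewrite ltr_norml; set c := _ * r => *; apply/andP; split; lra.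
Qed.

End continuity.

Lemma real_law_unique (R : realType) (mu nu : probability R R) :
  (forall t, mu [set x | x <= t] = nu [set x | x <= t]) ->
  forall A, measurable A -> mu A = nu A.
Proof.
move=> munu A mA.
apply: (measure_unique (@RGenOInfty.G R) (fun n => `]- n%:R, +oo[%classic)) => //.
- exact: RGenOInfty.measurableE.
- move=> _ _ [x ->] [y ->]; exists (Num.max x y).
  apply/seteqP; split => z /=; rewrite !in_itv/= !andbT gt_max.
    by move=> [-> ->].
  by move=> /andP[].
- by move=> n; exists (- n%:R).
- apply/seteqP; split => // x _; exists (Num.bound x) => //=.
  by rewrite in_itv/= andbT ltrNl unstable.ltrNbound.
- move=> _ [x ->].
  have mle : measurable [set y : R | y <= x] by exact: measurable_le.
  have -> : `]x, +oo[%classic = ~` [set y | y <= x].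
    by apply/seteqP; split => y /=; rewrite in_itv/= andbT ltNge => /negP.
  transitivity (1 - mu [set y | (y <= x)%R])%E; first exact: probability_setC.
  by rewrite munu; apply/esym; exact: probability_setC.
- move=> n; apply: le_lt_trans (probability_le1 mu _) (ltry _).
  exact: measurable_itv.
Qed.

(** * Independent coordinates *)

Section independence.
Context {R : realType} {d : nat}.
Implicit Types F G : probability (d.-tuple R) R.

Definition coord (j : 'I_d) (x : d.-tuple R) : R := tnth x j.

Lemma measurable_coord_fun j : measurable_fun setT (coord j).
Proof. exact: measurable_tnth. Qed.

HB.instance Definition _ j :=
  isMeasurableFun.Build _ _ _ _ (coord j) (measurable_coord_fun j).

Lemma measurable_map_coord (f : 'I_d -> R -> R) :
  (forall j, measurable_fun setT (f j)) ->
  measurable_fun setT (fun x : d.-tuple R => [tuple f j (tnth x j) | j < d]).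
Proof.
move=> mf; apply/measurable_fun_tnthP => j.
rewrite (_ : _ \o _ = f j \o coord j); last first.
  by apply/funext => x /=; rewrite tnth_mktuple.
exact: measurableT_comp.
Qed.

Definition unif_cube : probability (d.-tuple R) R := power_probability (unif R) d.

Definition clamp_prod (u : d.-tuple R) : R := \prod_(j < d) clamp (tnth u j).

Lemma clamp_prod01 u : 0 <= clamp_prod u <= 1.
Proof.
rewrite prodr_ge0 => [|j _]; last exact: clamp_ge0.
by apply: prodr_ile1 => j _; rewrite clamp_ge0 clamp_le1.
Qed.

Lemma measurable_clamp_prod : measurable_fun setT clamp_prod.
Proof.
apply: measurable_prod => j _; apply: measurableT_comp => //.
exact: measurable_tnth.
Qed.

HB.instance Definition _ :=
  isMeasurableFun.Build _ _ _ _ clamp_prod measurable_clamp_prod.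

Lemma unif_cube_coord (j : 'I_d) (B : set R) : measurable B ->
  unif_cube [set x | B (tnth x j)] = unif R B.
Proof.
move=> mB.
pose B' (i : 'I_d) := if i == j then B else setT.
have -> : [set x | B (tnth x j)] = box B'.
  apply/seteqP; split => x /=.
    by move=> Bx i; rewrite /B'; case: eqP => // ->.
  by move=> /(_ j); rewrite /B' eqxx.
rewrite /unif_cube power_probability_box; last by move=> i; rewrite /B'; case: ifP.
rewrite (bigD1 j)//= {1}/B' eqxx big1 ?mule1// => i ij.
by rewrite /B' (negbTE ij) probability_setT.
Qed.

Lemma independent_unif_cube : independent_coordinates unif_cube.
Proof.
move=> B mB; rewrite (power_probability_box (unif R) mB).
under eq_bigr do rewrite -[unif R _]fineK ?fin_num_measure//.
rewrite prodEFin /=; apply: eq_bigr => j _.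
by rewrite unif_cube_coord.
Qed.

Lemma continuous_unif_cube : continuous_df unif_cube.
Proof.
apply: (@lipschitz_continuous_df _ _ _ 1) => j a b ab; rewrite mul1r.
apply: (@uniform_itv _ _ _ unif_cube (coord j)) => // t.
rewrite -unif_le; apply: (@unif_cube_coord j [set x | x <= t]).
exact: measurable_le.
Qed.

Lemma Cstar_unif_cube : Cstar unif_cube.
Proof.
split; first exact: continuous_unif_cube.
exists unif_cube; split => //; first exact: continuous_unif_cube.
exact: independent_unif_cube.
Qed.

Lemma measurable_coord_ge (j : 'I_d) (a : R) :
  measurable [set x : d.-tuple R | a <= tnth x j].
Proof. exact: (@measurable_coord _ _ j [set y | a <= y] (measurable_ge a)). Qed.

Definition survival G j (a : R) : R := fine (G [set x | a <= tnth x j]).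

Lemma survival01 G j a : 0 <= survival G j a <= 1.
Proof.
rewrite fine_ge0//=.
have -> : 1 = fine (1%:E : \bar R) by [].
rewrite fine_le ?fin_num_measure//; last first.
  by rewrite probability_le1//; exact: measurable_coord_ge.
exact: measurable_coord_ge.
Qed.

Lemma measurable_survival G j : measurable_fun setT (survival G j).
Proof.
apply: nonincreasing_measurable => // a b ab.
have m c : measurable [set x : d.-tuple R | c <= tnth x j].
  exact: measurable_coord_ge.
rewrite fine_le ?fin_num_measure// le_measure ?inE//.
by move=> x /=; exact: le_trans.
Qed.

Lemma survival_unif G j : continuous_df G ->
  forall B, measurable B ->
  G [set x | B (survival G j (tnth x j))] = unif R B.
Proof.
move=> cG.
pose h x := survival G j (coord j x).
have mh : measurable_fun setT h.
  by apply: measurableT_comp => //; exact: measurable_survival.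
pose h_mfun : {mfun d.-tuple R >-> R} :=
  HB.pack h (isMeasurableFun.Build _ _ _ _ h mh).
apply: (@real_law_unique _ (distribution G h_mfun) (unif R)) => t.
rewrite unif_le -(@law_survival_uniform _ (distribution G (coord j))) //.
by move=> a; exact: continuous_df_atomless.
Qed.

Lemma H_opp_le_survival G j x : H_opp G x <= survival G j (tnth x j).
Proof.
have m : measurable [set y : d.-tuple R | tnth x j <= tnth y j].
  exact: measurable_coord_ge.
rewrite -lee_fin H_oppE fineK ?fin_num_measure// le_measure ?inE//.
  exact: measurable_ge_vec.
by move=> y; exact.
Qed.

(** By independence [H_opp G] is the product of the marginal survival
    functions, and mapping each coordinate by its survival function turns [G]
    into the uniform law on the cube. *)
Lemma H_opp_law G : continuous_df G -> independent_coordinates G ->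
  forall A, measurable A ->
  distribution G (H_opp G) A = distribution unif_cube clamp_prod A.
Proof.
move=> cG iG A mA.
have HE x : H_opp G x = clamp_prod [tuple survival G j (tnth x j) | j < d].
  have := iG (fun j => [set y | tnth x j <= y]) (fun j => measurable_ge _).
  rewrite /clamp_prod => iGx.
  rewrite (eq_bigr (fun j => survival G j (tnth x j))); last first.
    by move=> j _; rewrite tnth_mktuple clamp_id ?survival01.
  by rewrite -[RHS]iGx; apply: EFin_inj; rewrite H_oppE fineK// fin_num_measure//;
    exact: measurable_ge_vec.
pose Phi x := [tuple survival G j (tnth x j) | j < d].
have mPhi : measurable_fun setT Phi.
  by apply: measurable_map_coord => j; exact: measurable_survival.
pose Phi_mfun : {mfun d.-tuple R >-> d.-tuple R} :=
  HB.pack Phi (isMeasurableFun.Build _ _ _ _ Phi mPhi).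
have mVA : measurable (clamp_prod @^-1` A).
  by rewrite -[X in measurable X]setTI; exact: measurable_clamp_prod.
transitivity (distribution G Phi_mfun (clamp_prod @^-1` A)).
  by rewrite /distribution /pushforward; congr (G _); apply/seteqP; split => x /=;
    rewrite HE.
apply: (@power_probability_unique _ _ _ (unif R) d
  (distribution G Phi_mfun)) => // B mB.
have mB' j : measurable (survival G j @^-1` (B j)).
  by rewrite -[X in measurable X]setTI; exact: measurable_survival.
have mb : measurable (Phi @^-1` (box B)).
  by rewrite -[X in measurable X]setTI; exact: (mPhi measurableT _ (measurable_box mB)).
transitivity (fine (G (Phi @^-1` (box B))))%:E.
  by rewrite fineK// fin_num_measure.
have -> : Phi @^-1` (box B) =
    [set x | forall j, (survival G j @^-1` (B j)) (tnth x j)].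
  by apply/seteqP; split => x /= Bx j; have := Bx j; rewrite tnth_mktuple.
rewrite (iG (fun j => survival G j @^-1` B j))// -prodEFin; apply: eq_bigr => j _.
rewrite survival_unif// fineK// fin_num_measure//.
Qed.

(** In particular all the elements of the class are equivalent to each other. *)
Lemma Cstar_law F : Cstar F -> forall A, measurable A ->
  distribution F (H_opp F) A = distribution unif_cube clamp_prod A.
Proof.
move=> [_ [G [cG iG FG]]] A mA; rewrite FG//; exact: H_opp_law.
Qed.

End independence.

(** * A contraction inequality for products of uniform variables *)

Section contraction.
Context {R : realType}.

Lemma unif_clamp_le (t : R) : unif R [set x | clamp x <= t] = (clamp t)%:E.
Proof.
have [t0|t0] := ltP t 0.
  rewrite clamp_eq0 ?ltW// (_ : mkset _ = set0) ?measure0//.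
  by rewrite -subset0 => x /=; have := clamp_ge0 x => ? ?; lra.
have [t1|t1] := leP 1 t.
  rewrite clamp_eq1// (_ : mkset _ = setT) ?probability_setT//.
  by apply/seteqP; split => // x _ /=; have := clamp_le1 x => ?; lra.
rewrite -unif_le; congr (unif R _); apply/seteqP; split => x /=;
  by rewrite clamp_le// t0 t1.
Qed.

Lemma measurable_clamp_le (t : R) : measurable [set x : R | clamp x <= t].
Proof.
rewrite -[X in measurable X]setTI.
exact: (measurable_clamp measurableT (measurable_le t)).
Qed.

(** Both sides are 0 for [t < 0], and [t / w] for [0 <= t < th * w]; in the
    other cases the left-hand side is at most [th], and the right-hand side at
    least that. *)
Lemma unif_contraction (th w t : R) : 0 <= th <= 1 -> 0 <= w <= 1 ->
  (th%:E * unif R [set x | (th * (clamp x * w) <= t)%R] <=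
   unif R [set x | (clamp x * w <= t)%R])%E.
Proof.
move=> /andP[th0 th1] /andP[w0 w1].
have m0 c : measurable [set x : R | c * (clamp x * w) <= t].
  rewrite -[X in measurable X]setTI.
  have mf : measurable_fun setT (fun x : R => c * (clamp x * w)).
    apply: measurable_funM => //; exact: measurable_funM.
  exact: (mf measurableT _ (measurable_le t)).
have le1 c : (unif R [set x | (c * (clamp x * w) <= t)%R] <= 1)%E.
  exact: probability_le1.
have [t0|t0] := ltP t 0.
  rewrite (_ : [set x | th * _ <= t] = set0) ?measure0 ?mule0//.
  rewrite -subset0 => x /=; have := clamp_ge0 x => c0.
  have : 0 <= th * (clamp x * w) by rewrite !mulr_ge0.
  by lra.
have [wt|tw] := leP w t.
  rewrite (_ : [set x | clamp x * w <= t] = setT); last first.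
    apply/seteqP; split => // x _ /=; apply: le_trans wt.
    by rewrite ler_piMl// clamp_le1.
  rewrite probability_setT -[leRHS]mule1 lee_pmul// lee_fin.
have w_gt0 : 0 < w by exact: le_lt_trans tw.
have -> : [set x | clamp x * w <= t] = [set x | clamp x <= t / w].
  by apply/seteqP; split => x /=; rewrite ler_pdivlMr.
rewrite unif_clamp_le clamp_id; last first.
  by rewrite divr_ge0// ler_pdivrMr// mul1r ltW.
have [thw|tthw] := leP (th * w) t.
  apply: (@le_trans _ _ th%:E); first by rewrite -[leRHS]mule1 lee_pmul.
  by rewrite lee_fin ler_pdivlMr.
have thw0 : 0 < th * w by exact: le_lt_trans tthw.
have th_gt0 : 0 < th by move: thw0; rewrite pmulr_lgt0.
have -> : [set x | th * (clamp x * w) <= t] = [set x | clamp x <= t / (th * w)].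
  by apply/seteqP; split => x /=; rewrite ler_pdivlMr// mulrCA.
rewrite unif_clamp_le clamp_id; last first.
  by rewrite divr_ge0 ?(ltW thw0)// ler_pdivrMr// mul1r ltW.
rewrite -EFinM lee_fin invfM mulrCA [th * _]mulrA divff ?mul1r//.
by rewrite gt_eqF.
Qed.

Lemma clamp_prod_cons d (x : R) (y : d.-tuple R) :
  clamp_prod (cons_pair (x, y)) = clamp x * clamp_prod y.
Proof.
rewrite /clamp_prod big_ord_recl; congr (_ * _).
by apply: eq_bigr => j _; rewrite tnthS.
Qed.

Lemma measurable_clamp_prod_le d (c t : R) :
  measurable [set u : d.-tuple R | c * clamp_prod u <= t].
Proof.
rewrite -[X in measurable X]setTI.
have mf : measurable_fun setT (fun u : d.-tuple R => c * clamp_prod u).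
  exact: measurable_funM.
exact: (mf measurableT _ (measurable_le t)).
Qed.

Lemma measurable_slice d (c t : R) :
  measurable [set z : R * d.-tuple R | c * (clamp z.1 * clamp_prod z.2) <= t].
Proof.
rewrite -[X in measurable X]setTI.
have mf : measurable_fun setT
    (fun z : R * d.-tuple R => c * (clamp z.1 * clamp_prod z.2)).
  apply: measurable_funM => //; apply: measurable_funM.
    exact: (measurableT_comp measurable_clamp measurable_fst).
  exact: (measurableT_comp measurable_clamp_prod measurable_snd).
exact: (mf measurableT _ (measurable_le t)).
Qed.

(** Conditioning on all the factors but the first. *)
Lemma unif_cube_slice d (c t : R) :
  unif_cube [set u : d.+1.-tuple R | c * clamp_prod u <= t] =
  (\int[@unif_cube R d]_y unif R [set x | (c * (clamp x * clamp_prod y) <= t)%R])%E.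
Proof.
pose A := [set z : R * d.-tuple R | c * (clamp z.1 * clamp_prod z.2) <= t].
transitivity ((unif R \x @unif_cube R d)%E A).
  rewrite /unif_cube/= /distribution /pushforward.
  congr ((_ \x _)%E _); apply/seteqP; split => -[x y] /=;
    by rewrite clamp_prod_cons.
transitivity ((unif R \x^ @unif_cube R d)%E A).
  apply: product_measure_unique; last exact: measurable_slice.
  by move=> B C mB mC; exact: product_measure2E.
apply: eq_integral => y _ /=; congr (unif R _).
by apply/seteqP; split => x; rewrite /ysection/= inE.
Qed.

Lemma clamp_prod_contraction d (th t : R) : 0 <= th <= 1 ->
  (th%:E * unif_cube [set u : d.+1.-tuple R | (th * clamp_prod u <= t)%R] <=
   unif_cube [set u : d.+1.-tuple R | (clamp_prod u <= t)%R])%E.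
Proof.
move=> th01; have -> : [set u : d.+1.-tuple R | clamp_prod u <= t] =
    [set u | 1 * clamp_prod u <= t].
  by apply/seteqP; split => u /=; rewrite mul1r.
have mI c : measurable_fun setT (fun y : d.-tuple R =>
    unif R [set x | (c * (clamp x * clamp_prod y) <= t)%R]).
  have := @measurable_fun_ysection _ _ _ _ _ (unif R) _ (@measurable_slice d c t).
  congr measurable_fun; apply/funext => y /=; congr (unif R _).
  by apply/seteqP; split => x; rewrite /ysection/= inE.
rewrite !unif_cube_slice -ge0_integralZl//; last by rewrite lee_fin; case/andP: th01.
apply: ge0_le_integral => //.
- by move=> y _; rewrite mule_ge0// lee_fin; case/andP: th01.
- exact: measurable_funeM.
move=> y _; apply: le_trans (unif_contraction _ th01 (clamp_prod01 y)) _.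
rewrite (_ : [set x | 1 * _ <= t] = [set x | clamp x * clamp_prod y <= t])//.
by apply/seteqP; split => x /=; rewrite mul1r.
Qed.

(** The contraction inequality for [th = t], where its left-hand side is [t]
    because the product is at most 1. *)
Lemma clamp_prod_cdf_ge d (t : R) :
  ((clamp t)%:E <= unif_cube [set u : d.+1.-tuple R | (clamp_prod u <= t)%R])%E.
Proof.
have [t0|t0] := leP t 0; first by rewrite clamp_eq0.
have [t1|t1] := leP 1 t.
  rewrite clamp_eq1// (_ : mkset _ = setT) ?probability_setT//.
  apply/seteqP; split => // u _ /=; apply: le_trans t1.
  by have /andP[] := clamp_prod01 u.
have t01 : 0 <= t <= 1 by rewrite !ltW.
rewrite clamp_id//; apply: le_trans (clamp_prod_contraction _ _ t01).
rewrite (_ : mkset _ = setT) ?probability_setT ?mule1//.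
apply/seteqP; split => // u _ /=; rewrite ler_piMr ?(ltW t0)//.
by have /andP[] := clamp_prod01 u.
Qed.

End contraction.

(** * A family from the comonotone to the independent law *)

Lemma distributionE d1 d2 (T1 : measurableType d1) (T2 : measurableType d2)
    (R : realType) (P : probability T1 R) (X : {mfun T1 >-> T2}) (A : set T2) :
  distribution P X A = P (X @^-1` A).
Proof. by []. Qed.

Section family.
Context {R : realType} {d : nat}.
Local Notation V := (d.+1.-tuple R).
Implicit Types th t : R.

Definition seed : probability (R * V)%type R := (unif R \x @unif_cube R d.+1)%E.

Lemma seedX (A : set R) (B : set V) : measurable A -> measurable B ->
  seed (A `*` B) = (unif R A * unif_cube B)%E.
Proof. by move=> mA mB; exact: product_measure1E. Qed.

Lemma seed_fst (A : set R) : measurable A -> seed [set w | A w.1] = unif R A.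
Proof.
move=> mA; rewrite (_ : mkset _ = A `*` setT).
  by rewrite seedX// probability_setT mule1.
by apply/seteqP; split => -[z u] /= => [|[]].
Qed.

Lemma seed_snd (B : set V) : measurable B -> seed [set w | B w.2] = unif_cube B.
Proof.
move=> mB; rewrite (_ : mkset _ = setT `*` B).
  by rewrite seedX// probability_setT mul1e.
by apply/seteqP; split => -[z u] /= => [|[]].
Qed.

(** Coordinates are negated so that survival probabilities become values of
    distribution functions of uniform variables; the shift by -1 puts the
    comonotone block below the independent one. *)
Definition splice th (w : R * V) : V :=
  [tuple if th < clamp w.1 then -1 - clamp w.1 else - clamp (tnth w.2 j) | j < d.+1].

Lemma measurable_splice th : measurable_fun setT (splice th).
Proof.
have mc1 : measurable_fun setT (fun w : R * V => clamp w.1).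
  exact: (measurableT_comp measurable_clamp measurable_fst).
apply/measurable_fun_tnthP => j.
rewrite (_ : _ \o _ = fun w : R * V =>
    if th < clamp w.1 then -1 - clamp w.1 else - clamp (tnth w.2 j)); last first.
  by apply/funext => w /=; rewrite tnth_mktuple.
apply: measurable_fun_ifT.
- exact: measurable_fun_ltr.
- exact: measurable_funB.
- apply: measurable_funN; apply: (measurableT_comp measurable_clamp).
  exact: (measurableT_comp (measurable_tnth j) measurable_snd).
Qed.

HB.instance Definition _ th :=
  isMeasurableFun.Build _ _ _ _ (splice th) (measurable_splice th).

Definition splice_law th : probability V R := distribution seed (splice th).

Lemma splice_lawE th A : splice_law th A = seed (splice th @^-1` A).
Proof. by []. Qed.

(** [H_opp (splice_law th)] in terms of the seed. *)
Definition splice_H_opp th (w : R * V) : R :=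
  if th < clamp w.1 then clamp w.1 else th * clamp_prod w.2.

Lemma measurable_splice_H_opp th : measurable_fun setT (splice_H_opp th).
Proof.
have mc1 : measurable_fun setT (fun w : R * V => clamp w.1).
  exact: (measurableT_comp measurable_clamp measurable_fst).
apply: measurable_fun_ifT => //; first exact: measurable_fun_ltr.
apply: measurable_funM => //.
exact: (measurableT_comp measurable_clamp_prod measurable_snd).
Qed.

(** A point of the comonotone block with parameter [z] is dominated by the
    whole independent block and by the comonotone points with parameter at
    most [z], that is, by all seeds with parameter at most [z]. A point of the
    independent block is dominated inside that block only, which has mass
    [th]. *)
Lemma H_opp_splice th w : 0 <= th <= 1 ->
  H_opp (splice_law th) (splice th w) = splice_H_opp th w.
Proof.
move=> /andP[th0 th1]; case: w => z u; apply: EFin_inj; rewrite H_oppE.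
rewrite /splice_H_opp -[(z, u).1]/z -[(z, u).2]/u.
rewrite -[LHS]/(seed (splice th @^-1` [set y | le_vec (splice th (z, u)) y])).
case: ifPn => [thz|]; last rewrite -leNgt => zth.
  rewrite -[in RHS](@clamp_id _ (clamp z)) ?clamp_ge0 ?clamp_le1// -unif_clamp_le.
  rewrite -seed_fst; last exact: measurable_clamp_le.
  congr (seed _); apply/seteqP; split => -[z' u'] /=.
    move=> /(_ ord0); rewrite !tnth_mktuple /= thz; case: ifPn => [_|].
      by lra.
    by rewrite -leNgt; lra.
  move=> zz j; rewrite !tnth_mktuple /= thz; case: ifPn => [_|_]; first lra.
  by have := clamp_le1 (tnth u' j); have := clamp_ge0 z; lra.
rewrite (_ : _ @^-1` _ = [set z' | clamp z' <= th] `*`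
   box (fun j => [set x | clamp x <= clamp (tnth u j)])); last first.
  apply/seteqP; split => -[z' u'] /=.
    move=> H; split.
      rewrite leNgt; apply/negP => thz'.
      have := H ord0; rewrite !tnth_mktuple /= thz' ltNge zth/=.
      by have := clamp_le1 (tnth u ord0); lra.
    move=> j /=; have := H j; rewrite !tnth_mktuple /= ltNge zth/=.
    case: ifPn => [thz'|_]; last by rewrite lerN2.
    by have := clamp_le1 (tnth u j); lra.
  move=> [z'th H] j; rewrite !tnth_mktuple /= !ltNge zth z'th /= lerN2.
  exact: H.
have mb j : measurable [set x : R | clamp x <= clamp (tnth u j)].
  exact: measurable_clamp_le.
rewrite seedX; [|exact: measurable_clamp_le|exact: measurable_box].
rewrite unif_clamp_le clamp_id ?th0// power_probability_box// EFinM; congr (_ * _)%E.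
rewrite /clamp_prod -prodEFin; apply: eq_bigr => j _.
by rewrite unif_clamp_le clamp_id// clamp_ge0 clamp_le1.
Qed.

Lemma leeD_double (p q : \bar R) (c : R) :
  (p <= c%:E -> q <= c%:E -> p + q <= (2 * c)%:E)%E.
Proof. by rewrite mulr_natl mulr2n EFinD => ? ?; exact: leeD. Qed.

(** On each axis the law of a block is uniform, so an interval gets at most
    its length from either of the two blocks. *)
Lemma continuous_splice_law th : continuous_df (splice_law th).
Proof.
apply: (@lipschitz_continuous_df _ _ _ 2) => j a b ab.
rewrite /splice_law /distribution /pushforward.
pose f (w : R * V) := clamp w.1; pose g (w : R * V) := clamp (tnth w.2 j).
have mf : measurable_fun setT f.
  exact: (measurableT_comp measurable_clamp measurable_fst).
have mg : measurable_fun setT g.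
  apply: (measurableT_comp measurable_clamp).
  exact: (measurableT_comp (measurable_tnth j) measurable_snd).
have mA (h : R * V -> R) (x y : R) : measurable_fun setT h ->
    measurable [set w | x <= h w <= y].
  move=> mh; rewrite -[X in measurable X]setTI.
  apply: (mh measurableT [set r | x <= r <= y]).
  by have := measurable_itv `[x, y]; rewrite set_itvcc.
have Pf : (seed [set w | (-1 - b <= f w <= -1 - a)%R] <= (b - a)%:E)%E.
  have -> : b - a = (-1 - a) - (-1 - b) by ring.
  apply: uniform_itv => //; last lra.
  move=> t; rewrite -unif_clamp_le -seed_fst//; exact: measurable_clamp_le.
have Pg : (seed [set w | (- b <= g w <= - a)%R] <= (b - a)%:E)%E.
  have -> : b - a = (- a) - (- b) by ring.
  apply: uniform_itv => //; last lra.
  move=> t; rewrite -unif_clamp_le.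
  have mt : measurable [set x : R | clamp x <= t] by exact: measurable_clamp_le.
  rewrite -(unif_cube_coord j mt) -seed_snd//.
  exact: (@measurable_coord _ _ j _ mt).
apply: (@le_trans _ _ (seed ([set w | (-1 - b <= f w <= -1 - a)%R] `|`
    [set w | (- b <= g w <= - a)%R]))).
  have mab : measurable [set x : V | a <= tnth x j <= b].
    apply: (@measurable_coord _ _ j [set x | a <= x <= b]).
    by have := measurable_itv `[a, b]; rewrite set_itvcc.
  rewrite -[leLHS]/(seed (splice th @^-1` [set x | (a <= tnth x j <= b)%R])).
  apply: le_measure; rewrite ?inE.
  - by rewrite -[X in measurable X]setTI; exact: (measurable_splice th measurableT mab).
  - by apply: measurableU; exact: mA.
  - move=> w /=; rewrite tnth_mktuple; case: ifP => _ /andP[? ?]; [left|right];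
      by apply/andP; split; rewrite /f /g; lra.
apply: le_trans (measureU2 _ _ _) _; [exact: mA|exact: mA|].
exact: leeD_double Pf Pg.
Qed.

(** For [t < th] only the independent block contributes and the claim is the
    contraction inequality. For [t >= th] the event forces [z <= t], and the
    product of uniforms is stochastically smaller than a uniform variable. *)
Lemma splice_H_opp_cdf th t : 0 <= th <= 1 ->
  (seed [set w | (splice_H_opp th w <= t)%R] <=
   unif_cube [set u : V | (clamp_prod u <= t)%R])%E.
Proof.
move=> th01; have /andP[th0 th1] := th01.
have mS : measurable [set w | splice_H_opp th w <= t].
  rewrite -[X in measurable X]setTI.
  exact: (measurable_splice_H_opp th measurableT (measurable_le t)).
have [tth|tht] := ltP t th.
  apply: le_trans (clamp_prod_contraction d t th01).
  have := seedX (measurable_clamp_le th) (@measurable_clamp_prod_le _ d.+1 th t).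
  rewrite unif_clamp_le clamp_id// => <-.
  apply: le_measure; rewrite ?inE//.
    apply: measurableX; first exact: measurable_clamp_le.
    exact: measurable_clamp_prod_le.
  move=> -[z u]; rewrite /splice_H_opp /=; case: ifPn => [thz zt|]; last first.
    by rewrite -leNgt => ? ?; split.
  by lra.
apply: le_trans (clamp_prod_cdf_ge d t).
rewrite -unif_clamp_le -seed_fst; last exact: measurable_clamp_le.
apply: le_measure; rewrite ?inE//.
  rewrite -[X in measurable X]setTI.
  exact: (measurable_fst measurableT _ (measurable_clamp_le t)).
move=> -[z u]; rewrite /splice_H_opp /=; case: ifPn => //.
by rewrite -leNgt => + _ => /le_trans; exact.
Qed.

End family.

(** * Record probabilities *)

Lemma integral_probability_cst d (T : measurableType d) (R : realType)
  (P : probability T R) (c : R) : (\int[P]__ c%:E = c%:E)%E.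
Proof.
by rewrite integral_cst// -[RHS]mule1; congr (_ * _)%E; exact: probability_setT.
Qed.

Section record_values.
Context {R : realType} {d : nat}.
Local Notation V := (d.+1.-tuple R).
Implicit Types (F G : probability V R) (m : nat).

Lemma record_funE0 m (y : R) : (0 <= (record_fun m y)%:E)%E.
Proof. by rewrite lee_fin record_fun_ge0. Qed.

Lemma measurable_record_funE m :
  measurable_fun [set: R] (fun y : R => (record_fun m y)%:E).
Proof. by apply/measurable_EFinP; exact: measurable_record_fun. Qed.

Lemma record_prob_Cstar F m : Cstar F -> (record_prob m.+1 F)%:E =
  (\int[@unif_cube R d.+1]_u (record_fun m (clamp_prod u))%:E)%E.
Proof.
move=> CF; rewrite record_probE.
transitivity (\int[distribution (@unif_cube R d.+1) clamp_prod]_y (record_fun m y)%:E)%E.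
  by apply: eq_measure_integral => A mA _; exact: Cstar_law.
rewrite ge0_integral_distribution//; last by move=> y; exact: record_funE0.
exact: measurable_record_funE.
Qed.

Lemma record_prob_starE m : (record_prob_star R d.+1 m.+1)%:E =
  (\int[@unif_cube R d.+1]_u (record_fun m (clamp_prod u))%:E)%E.
Proof.
have [F CF <-] : [set record_prob m.+1 F | F in @Cstar R d.+1]
    (record_prob_star R d.+1 m.+1).
  apply: getPex; exists (record_prob m.+1 (@unif_cube R d.+1)).
  by exists unif_cube => //; exact: Cstar_unif_cube.
exact: record_prob_Cstar.
Qed.

Lemma record_prob_ge F m : continuous_df F -> m.+1%:R^-1 <= record_prob m.+1 F.
Proof.
move=> cF; rewrite -lee_fin record_probE ge0_integral_distribution//; last 2 first.
- exact: measurable_record_funE.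
- by move=> y; exact: record_funE0.
pose h (x : V) := survival F ord0 (tnth x ord0).
have mh : measurable_fun setT h.
  apply: (measurableT_comp (measurable_survival F ord0)); exact: measurable_tnth.
pose h_mfun : {mfun V >-> R} := HB.pack h (isMeasurableFun.Build _ _ _ _ h mh).
have -> : (m.+1%:R^-1)%:E = (\int[distribution F h_mfun]_y (record_fun m y)%:E)%E.
  rewrite -(integral_unif_onemX R m); apply: eq_measure_integral => A mA _.
  by apply/esym; exact: (survival_unif ord0 cF mA).
rewrite ge0_integral_distribution//; last 2 first.
- exact: measurable_record_funE.
- by move=> y; exact: record_funE0.
apply: ge0_le_integral => //.
- by move=> x _; exact: record_funE0.
- exact: (measurableT_comp (measurable_record_funE m) mh).
- exact: (measurableT_comp (measurable_record_funE m) (measurable_H_opp F)).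
- move=> x _ /=; rewrite lee_fin; apply: record_fun_homo; exact: H_opp_le_survival.
Qed.

(** The uniform law on the cube serves as the element of the class [C^*] to
    which [F] is compared. *)
Lemma record_prob_le F m : PRPD F ->
  record_prob m.+1 F <= record_prob_star R d.+1 m.+1.
Proof.
move=> [_ /(_ _ (@Cstar_unif_cube R d.+1)) FQ].
rewrite -lee_fin record_prob_starE -(record_prob_Cstar m (@Cstar_unif_cube R d.+1)).
rewrite !record_probE.
apply: (@antitone_integral_le _ _ _ (record_fun m)).
- by move=> t; have := FQ t; rewrite /ccdf set_itvoy.
- by move=> y; exact: record_fun_ge0.
- by move=> x y xy; exact: record_fun_homo.
Qed.

Lemma splice_law_PRPD (th : R) : 0 <= th <= 1 -> PRPD (@splice_law R d th).
Proof.
move=> th01; split; first exact: continuous_splice_law.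
move=> G CG t; rewrite /ccdf (Cstar_law CG)//.
have mS : measurable [set w : R * V | splice_H_opp th w <= t].
  rewrite -[X in measurable X]setTI.
  exact: (measurable_splice_H_opp th measurableT (measurable_le t)).
have mQ : measurable [set u : V | clamp_prod u <= t].
  rewrite -[X in measurable X]setTI.
  exact: (measurable_clamp_prod measurableT (measurable_le t)).
have splice_gt : splice th @^-1` (H_opp (splice_law th) @^-1` `]t, +oo[) =
    ~` [set w : R * V | splice_H_opp th w <= t].
  apply/seteqP; split => w /=; rewrite in_itv/= andbT H_opp_splice//.
    by rewrite ltNge => /negP.
  by move=> /negP; rewrite -ltNge.
have prod_gt : @clamp_prod R d.+1 @^-1` `]t, +oo[ = ~` [set u : V | clamp_prod u <= t].
  apply/seteqP; split => w /=; rewrite in_itv/= andbT.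
    by rewrite ltNge => /negP.
  by move=> /negP; rewrite -ltNge.
rewrite !distributionE splice_lawE splice_gt prod_gt.
by rewrite !probability_setC// leeB// splice_H_opp_cdf.
Qed.

Lemma record_prob_splice (th : R) m : 0 <= th <= 1 ->
  (record_prob m.+1 (@splice_law R d th))%:E =
  (\int[@seed R d]_w (record_fun m (splice_H_opp th w))%:E)%E.
Proof.
move=> th01; rewrite record_probE ge0_integral_distribution//; last 2 first.
- exact: measurable_record_funE.
- by move=> y; exact: record_funE0.
rewrite ge0_integral_distribution//; last 2 first.
- exact: (measurableT_comp (measurable_record_funE m) (measurable_H_opp _)).
- by move=> y; exact: record_funE0.
by apply: eq_integral => w _ /=; rewrite H_opp_splice.
Qed.

Lemma record_prob_splice0 m : record_prob m.+1 (@splice_law R d 0) = m.+1%:R^-1.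
Proof.
apply: EFin_inj; rewrite record_prob_splice ?lexx ?ler01//.
rewrite -integral_unif_onemX.
rewrite fubini_tonelli1; last 2 first.
- exact: (measurableT_comp (measurable_record_funE m) (measurable_splice_H_opp 0)).
- by move=> w; exact: record_funE0.
apply: eq_integral => z _; rewrite /fubini_F.
rewrite -[RHS](integral_probability_cst (@unif_cube R d.+1)).
apply: eq_integral => u _.
rewrite -[X in (1 - X) ^+ m]clamp_id ?clamp_ge0 ?clamp_le1//.
rewrite /splice_H_opp/= mul0r; congr (record_fun _ _)%:E.
by case: ltP => // c0; apply/eqP; rewrite eq_le c0 clamp_ge0.
Qed.

Lemma record_prob_splice1 m :
  record_prob m.+1 (@splice_law R d 1) = record_prob_star R d.+1 m.+1.
Proof.
apply: EFin_inj; rewrite record_prob_splice ?lexx ?ler01// record_prob_starE.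
rewrite fubini_tonelli2; last 2 first.
- exact: (measurableT_comp (measurable_record_funE m) (measurable_splice_H_opp 1)).
- by move=> w; exact: record_funE0.
apply: eq_integral => u _; rewrite /fubini_G.
rewrite -[RHS](integral_probability_cst (unif R)); apply: eq_integral => z _.
by rewrite /splice_H_opp/= mul1r ltNge clamp_le1.
Qed.

Lemma record_fun_lip m (x y : R) : x <= y ->
  record_fun m x - record_fun m y <= m%:R * (y - x).
Proof.
move=> xy; elim: m => [|m ih]; first by rewrite /record_fun !expr0 subrr mul0r.
have cxy := clamp_homo xy; have fyx := record_fun_homo m xy.
have E (z : R) : record_fun m.+1 z = (1 - clamp z) * record_fun m z.
  by rewrite /record_fun exprS.
rewrite !E (_ : _ - _ = (1 - clamp x) * (record_fun m x - record_fun m y) +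
  (clamp y - clamp x) * record_fun m y); last by ring.
rewrite -natr1 [leRHS]mulrDl mul1r lerD//.
  apply: le_trans ih; rewrite ler_piMl ?subr_ge0//.
  by rewrite lerBlDr lerDl clamp_ge0.
apply: le_trans (clamp_lip xy); rewrite ler_piMr ?subr_ge0//.
exact: record_fun_le1.
Qed.

(** The two parameters choose different blocks only when [th < z <= th'], and
    then the difference is at most 1. When both choose the independent block,
    the arguments of [record_fun] differ by at most [th' - th]. *)
Lemma record_fun_splice_le (th th' : R) m (w : R * V) :
  0 <= th -> th <= th' -> th' <= 1 ->
  `|record_fun m (splice_H_opp th w) - record_fun m (splice_H_opp th' w)| <=
  m%:R * (th' - th) + \1_[set w : R * V | th <= clamp w.1 <= th'] w.
Proof.
move=> th0 thth' th'1; have m0 : 0 <= m%:R * (th' - th) by rewrite mulr_ge0// subr_ge0.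
have /andP[V0 V1] := clamp_prod01 w.2.
rewrite /splice_H_opp; have [wth|thw] := leP (clamp w.1) th.
  rewrite ltNge (le_trans wth)//=.
  apply: (@le_trans _ _ (m%:R * (th' - th))); last by rewrite lerDl.
  rewrite ger0_norm ?subr_ge0; last by apply: record_fun_homo; rewrite ler_wpM2r.
  apply: (le_trans (record_fun_lip m _)); first by rewrite ler_wpM2r.
  by rewrite -mulrBl ler_wpM2l// ler_piMr// subr_ge0.
have [wth'|th'w] := leP (clamp w.1) th'; last by rewrite subrr normr0 addr_ge0.
rewrite indicE mem_set/=; last by rewrite wth' ltW.
have := record_fun_ge0 m (clamp w.1); have := record_fun_le1 m (clamp w.1).
have := record_fun_ge0 m (th' * clamp_prod w.2).
have := record_fun_le1 m (th' * clamp_prod w.2).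
by move=> *; rewrite ler_norml; apply/andP; split; lra.
Qed.

(** Passing from [th] to [th'] changes the integrand by at most
    [m * (th' - th)], except on a slab of mass at most [th' - th], where it
    changes by at most 1 more. *)
Lemma splice_integral_lip (p : R -> R) m :
  (forall th, 0 <= th <= 1 ->
    (p th)%:E = (\int[@seed R d]_w (record_fun m (splice_H_opp th w))%:E)%E) ->
  forall th th', 0 <= th -> th <= th' -> th' <= 1 ->
    `|p th - p th'| <= m.+1%:R * (th' - th).
Proof.
move=> pE th th' th0 thth' th'1.
have th01 : 0 <= th <= 1 by rewrite th0 (le_trans thth').
have th01' : 0 <= th' <= 1 by rewrite th'1 (le_trans th0).
pose A := [set w : R * V | th <= clamp w.1 <= th'].
have mc : measurable_fun setT (fun w : R * V => clamp w.1).
  exact: (measurableT_comp measurable_clamp measurable_fst).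
have mA : measurable A.
  rewrite -[X in measurable X]setTI; apply: (mc measurableT [set x | th <= x <= th']).
  by have := measurable_itv `[th, th']; rewrite set_itvcc.
have PA : (seed A <= (th' - th)%:E)%E.
  apply: (@uniform_itv _ _ _ (@seed R d) (fun w => clamp w.1)) => // t.
  by rewrite -unif_clamp_le -(@seed_fst R d)//; exact: measurable_clamp_le.
have mr x : measurable_fun setT
    (fun w : R * V => (record_fun m (splice_H_opp x w))%:E).
  exact: (measurableT_comp (measurable_record_funE m) (measurable_splice_H_opp x)).
have key (x y : R) : 0 <= x <= 1 -> 0 <= y <= 1 ->
    (forall w : R * V,
      record_fun m (splice_H_opp x w) <= record_fun m (splice_H_opp y w) +
      (m%:R * (th' - th) + \1_A w)) ->
    p x <=
    p y + m.+1%:R * (th' - th).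
  move=> x01 y01 H.
  suff : ((p x)%:E <=
      (p y)%:E + (m.+1%:R * (th' - th))%:E)%E.
    by rewrite -EFinD lee_fin.
  rewrite (pE x x01) (pE y y01).
  apply: (@le_trans _ _ (\int[@seed R d]_w ((record_fun m (splice_H_opp y w))%:E +
      ((m%:R * (th' - th))%:E + (\1_A w)%:E)))%E).
    apply: ge0_le_integral => //.
    - by move=> w _; exact: record_funE0.
    - apply: emeasurable_funD => //; apply: emeasurable_funD => //.
      by apply/measurable_EFinP; exact: measurable_indic.
    - by move=> w _; rewrite -!EFinD lee_fin.
  have c0 : 0 <= m%:R * (th' - th) by rewrite mulr_ge0// subr_ge0.
  rewrite ge0_integralD//; last 3 first.
  - by move=> w _; exact: record_funE0.
  - by move=> w _; rewrite adde_ge0// lee_fin.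
  - apply: emeasurable_funD => //.
    by apply/measurable_EFinP; exact: measurable_indic.
  rewrite leeD2l// ge0_integralD//; last first.
    by apply/measurable_EFinP; exact: measurable_indic.
  rewrite integral_probability_cst integral_indic// setIT.
  have -> : m.+1%:R * (th' - th) = m%:R * (th' - th) + (th' - th).
    by rewrite -natr1 [LHS]mulrDl mul1r.
  by rewrite [leRHS]EFinD leeD2l.
have k1 := key th th' th01 th01'; have k2 := key th' th th01' th01.
rewrite ler_norml; apply/andP; split.
  suff : p th' <=
    p th + m.+1%:R * (th' - th) by lra.
  apply: k2 => w; have := record_fun_splice_le m w th0 thth' th'1.
  by rewrite ler_norml -/A => /andP[? ?]; lra.
suff : p th <=
    p th' + m.+1%:R * (th' - th) by lra.
apply: k1 => w; have := record_fun_splice_le m w th0 thth' th'1.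
by rewrite ler_norml -/A => /andP[? ?]; lra.
Qed.

Lemma record_prob_splice_lip (th th' : R) m :
  0 <= th -> th <= th' -> th' <= 1 ->
  `|record_prob m.+1 (@splice_law R d th) -
    record_prob m.+1 (@splice_law R d th')| <=
  m.+1%:R * (th' - th).
Proof.
apply: (@splice_integral_lip (fun x => record_prob m.+1 (@splice_law R d x))).
by move=> x; exact: record_prob_splice.
Qed.

Lemma continuous_record_prob_splice m :
  continuous (fun x : R => record_prob m.+1 (@splice_law R d (clamp x))).
Proof.
have lip (x y : R) : `|record_prob m.+1 (@splice_law R d (clamp x)) -
    record_prob m.+1 (@splice_law R d (clamp y))| <= m.+1%:R * `|x - y|.
  wlog xy : x y / x <= y => [H|].
    have [xy|/ltW yx] := leP x y; first exact: H.
    by rewrite distrC [`|x - y|]distrC; exact: H.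
  apply: le_trans (record_prob_splice_lip m (clamp_ge0 x) (clamp_homo xy)
    (clamp_le1 y)) _.
  by rewrite ler_wpM2l// distrC ger0_norm ?subr_ge0// clamp_lip.
move=> x; apply/cvgrPdist_lt => e e0; apply/nbhs_ballP.
exists (m.+1%:R^-1 * e) => [|y xy]; first by rewrite /= mulr_gt0// invr_gt0.
by apply: (le_lt_trans (lip x y)); rewrite -ltr_pdivlMl.
Qed.

End record_values.

Theorem theorem1p12 (R : realType) (d n : nat) (hd : (1 <= d)%N)
    (hn : (1 <= n)%N) :
  [set record_prob n F | F in @PRPD R d] =
  `[n%:R^-1, record_prob_star R d n]%classic.
Proof.
case: d hd => // d _; case: n hn => // m _.
apply/seteqP; split => v /=; rewrite in_itv/=.
  move=> [F pF <-]; rewrite record_prob_le// andbT.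
  by apply: record_prob_ge; case: pF.
move=> /andP[v0 v1].
pose f (x : R) := record_prob m.+1 (@splice_law R d (clamp x)).
have f0 : f 0 = m.+1%:R^-1 by rewrite /f clamp_eq0// record_prob_splice0.
have f1 : f 1 = record_prob_star R d.+1 m.+1.
  by rewrite /f clamp_eq1// record_prob_splice1.
have [] := @IVT R f 0 1 v ler01.
- by apply: continuous_subspaceT; exact: continuous_record_prob_splice.
- by rewrite f0 f1 ge_min le_max v0 v1 orbT.
move=> x _ <-; exists (@splice_law R d (clamp x)) => //.
by apply: splice_law_PRPD; rewrite clamp_ge0 clamp_le1.
Qed.
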